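(* There is no general recursive function $f:\mathbb{N}\to\mathbb{N}$ such that $f(s_3(n))\ge n$ for all $n\ge 1$.
   Context: Graphs are simple undirected graphs (finite or infinite), viewed as structures for the first-order language whose only relation symbols are the binary adjacency symbol $\sim$ and equality $=$. Formulas use connectives $\neg,\wedge,\vee$ and quantifiers over vertices. A sentence $A$ defines a finite graph $G$ if $A$ is true on $G$ and false on every graph (of any cardinality) not isomorphic to $G$. The length $|A|$ of a formula is the number of symbols in it, each variable and each relation symbol counting as a single symbol. For a formula $A$, the set $\mathrm{nest}(A)$ of sequences of nested quantifiers (words over $\{\exists,\forall\}$) is defined inductively: $\mathrm{nest}(A)=\{\text{empty word}\}$ for atomic $A$; $\mathrm{nest}(\neg A)$ is $\mathrm{nest}(A)$ with $\exists$ and $\forall$ interchanged in every word; $\mathrm{nest}(A\wedge B)=\mathrm{nest}(A\vee B)=\mathrm{nest}(A)\cup\mathrm{nest}(B)$; $\mathrm{nest}(\exists x A)=\{\exists w: w\in\mathrm{nest}(A)\}$ and similarly for $\forall$. The alternation number of a word is the number of occurrences of $\exists\forall$ and $\forall\exists$ as consecutive letters in it, and the alternation number of $A$ is the maximum over $\mathrm{nest}(A)$. $L_3(G)$ is the minimum length of a sentence in negation normal form with alternation number at most $3$ that defines $G$, and $s_3(n)=\min\{L_3(G): G \text{ a graph with } n \text{ vertices}\}$. *)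

(* Defs.v *)
From mathcomp Require Import all_boot.
Set Implicit Arguments.
Unset Strict Implicit.
Unset Printing Implicit Defensive.

Inductive recf : nat -> Type :=
| Rzero k : recf k
| Rsucc : recf 1
| Rproj k (i : 'I_k) : recf k
| Rcomp k m : recf m -> recfs k m -> recf k
| Rprec k : recf k -> recf k.+2 -> recf k.+1
| Rmin k : recf k.+1 -> recf k
with recfs : nat -> nat -> Type :=
| Rnil k : recfs k 0
| Rcons k m : recf k -> recfs k m -> recfs k m.+1.

Inductive eval : forall k, recf k -> seq nat -> nat -> Prop :=
| ev_zero k v : size v = k -> eval (Rzero k) v 0
| ev_succ x : eval Rsucc [:: x] x.+1
| ev_proj k (i : 'I_k) v : size v = k -> eval (Rproj i) v (nth 0 v i)
| ev_comp k m (g : recf m) (hs : recfs k m) v ws y :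
    evals hs v ws -> eval g ws y -> eval (Rcomp g hs) v y
| ev_prec0 k (g : recf k) (h : recf k.+2) v y :
    eval g v y -> eval (Rprec g h) (0 :: v) y
| ev_precS k (g : recf k) (h : recf k.+2) n v z y :
    eval (Rprec g h) (n :: v) z -> eval h (n :: z :: v) y ->
    eval (Rprec g h) (n.+1 :: v) y
| ev_min k (g : recf k.+1) v y :
    eval g (y :: v) 0 ->
    (forall z, z < y -> exists w, w <> 0 /\ eval g (z :: v) w) ->
    eval (Rmin g) v y
with evals : forall k m, recfs k m -> seq nat -> seq nat -> Prop :=
| evs_nil k v : evals (Rnil k) v [::]
| evs_cons k m (f : recf k) (fs : recfs k m) v y ys :
    eval f v y -> evals fs v ys -> evals (Rcons f fs) v (y :: ys).

Definition general_recursive (f : nat -> nat) : Prop :=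
  exists r : recf 1, forall n, eval r [:: n] (f n).

Record graph := Graph { vert : Type; adj : vert -> vert -> Prop }.

Definition simple_graph (G : graph) : Prop :=
  inhabited (vert G) /\
  (forall x y, @adj G x y -> @adj G y x) /\ (forall x, ~ @adj G x x).

Definition graph_iso (G H : graph) : Prop :=
  exists f : vert G -> vert H, bijective f /\
    forall x y, @adj G x y <-> @adj H (f x) (f y).

Definition fin_graph (T : finType) (e : rel T) : graph :=
  @Graph T (fun x y => e x y).

Definition fin_simple (T : finType) (e : rel T) : Prop :=
  symmetric e /\ irreflexive e.

Inductive form :=
| FAdj of nat & nat
| FEq of nat & nat
| FNeg of form
| FAnd of form & form
| FOr of form & form
| FEx of nat & form
| FAll of nat & form.

Definition upd (V : Type) (env : nat -> V) (x : nat) (v : V) : nat -> V :=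
  fun y => if y == x then v else env y.

Fixpoint sat (G : graph) (env : nat -> vert G) (A : form) : Prop :=
  match A with
  | FAdj x y => @adj G (env x) (env y)
  | FEq x y => env x = env y
  | FNeg B => ~ sat env B
  | FAnd B C => sat env B /\ sat env C
  | FOr B C => sat env B \/ sat env C
  | FEx x B => exists v, sat (upd env x v) B
  | FAll x B => forall v, sat (upd env x v) B
  end.

Fixpoint fv (A : form) : seq nat :=
  match A with
  | FAdj x y | FEq x y => [:: x; y]
  | FNeg B => fv B
  | FAnd B C | FOr B C => fv B ++ fv C
  | FEx x B | FAll x B => filter (predC1 x) (fv B)
  end.

Definition sentence (A : form) : bool := nilp (fv A).

Definition holds (G : graph) (A : form) : Prop :=
  forall env : nat -> vert G, sat env A.

Fixpoint nnf (A : form) : bool :=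
  match A with
  | FAdj _ _ | FEq _ _ => true
  | FNeg (FAdj _ _) | FNeg (FEq _ _) => true
  | FNeg _ => false
  | FAnd B C | FOr B C => nnf B && nnf C
  | FEx _ B | FAll _ B => nnf B
  end.

(* length: number of symbols; each variable, relation symbol, connective,
   quantifier and parenthesis counts as one symbol.
   x ~ y, x = y : 3;  neg A : 1 + |A|;  (A /\ B), (A \/ B) : |A|+|B|+3;
   exists x A, forall x A : 2 + |A|. *)
Fixpoint flen (A : form) : nat :=
  match A with
  | FAdj _ _ | FEq _ _ => 3
  | FNeg B => (flen B).+1
  | FAnd B C | FOr B C => flen B + flen C + 3
  | FEx _ B | FAll _ B => (flen B).+2
  end.

Fixpoint nest (A : form) : seq (seq bool) :=
  match A with
  | FAdj _ _ | FEq _ _ => [:: [::]]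
  | FNeg B => map (map negb) (nest B)
  | FAnd B C | FOr B C => nest B ++ nest C
  | FEx _ B => map (cons true) (nest B)
  | FAll _ B => map (cons false) (nest B)
  end.

Fixpoint word_alt (w : seq bool) : nat :=
  match w with
  | a :: ((b :: _) as w') => (a != b) + word_alt w'
  | _ => 0
  end.

Definition alt (A : form) : nat := \max_(w <- nest A) word_alt w.

Definition defines (A : form) (G : graph) : Prop :=
  sentence A /\ holds G A /\
  forall H : graph, simple_graph H -> ~ graph_iso H G -> ~ holds H A.

Definition def3 (A : form) (G : graph) : Prop :=
  nnf A /\ alt A <= 3 /\ defines A G.

(* is_s3 n m : m = s_3(n), i.e. m is the minimum of L_3(G) over graphs G
   with n vertices, i.e. the minimum length of an NNF sentence of
   alternation number <= 3 defining some graph on n vertices. *)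
Definition is_s3 (n m : nat) : Prop :=
  (exists (T : finType) (e : rel T) (A : form),
      [/\ #|T| = n, fin_simple e, def3 A (fin_graph e) & flen A = m]) /\
  (forall (T : finType) (e : rel T) (A : form),
      #|T| = n -> fin_simple e -> def3 A (fin_graph e) -> m <= flen A).

(* Main.v *)
(* For a recursive [f], a counter program of length O(N) first computes [2 ^ N]
   by N doublings and then sums [f i] over all [i < 2 ^ N].  Its halting run is
   coded as a finite graph with one vertex for each time, so with more vertices
   than every such [f i], and the graph is defined by a sentence of length
   O(N ^ 2), hence eventually of some length [m < 2 ^ N]: this contradicts
   [n <= f (s_3 n)].

   In the graph, colours are adjacencies to existentially quantified vertices; a
   time is adjacent to the colour of its state and, for each register, to as many
   vertices of that register's colour as the register's value.  The sentence asks
   that the neighbourhoods of times within each register colour form a chain under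
   inclusion, which makes each of them depend only on its size, and that each
   non-halting time has a successor time obeying the program.  Colour 0 is a
   clock, incremented at every step.  Following the run from the initial time, the
   clock exhausts its colour at the halting time, so that no further time can fit
   into the chain; hence infinite and non-standard models are excluded.  The
   successor axiom has the shape exists/forall/exists/forall, i.e. three
   alternations. *)
Require Import Defs.
From HB Require Import structures.
From mathcomp Require Import all_boot.
From mathcomp Require Import zify.
From Stdlib Require Import Classical IndefiniteDescription FunctionalExtensionality.
Set Implicit Arguments.
Unset Strict Implicit.
Unset Printing Implicit Defensive.

Notation store := (nat -> nat).

Lemma updE V (s : nat -> V) x v y : upd s x v y = if y == x then v else s y.
Proof. by []. Qed.

Lemma upd_same V (s : nat -> V) x : upd s x (s x) = s.
Proof. by apply: functional_extensionality => y; rewrite updE; case: eqP => // ->. Qed.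

Lemma upd_upd V (s : nat -> V) x v w : upd (upd s x v) x w = upd s x w.
Proof. by apply: functional_extensionality => y; rewrite !updE; case: eqP. Qed.

(** * Programs with loops *)

(** A round of [Loop x c] decrements [x] and then runs [c], which may change [x] again: this is a
    while loop, so unbounded search is expressible. *)
Inductive cmd :=
| Inc of nat
| Clr of nat
| Seq of cmd & cmd
| Loop of nat & cmd.

Inductive exec : cmd -> store -> store -> Prop :=
| exec_inc x s : exec (Inc x) s (upd s x (s x).+1)
| exec_clr x s : exec (Clr x) s (upd s x 0)
| exec_seq c d s s1 s2 : exec c s s1 -> exec d s1 s2 -> exec (Seq c d) s s2
| exec_loop0 x c s : s x = 0 -> exec (Loop x c) s s
| exec_loopS x c s s1 s2 : s x != 0 ->
    exec c (upd s x (s x).-1) s1 -> exec (Loop x c) s1 s2 ->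
    exec (Loop x c) s s2.

Definition runs c s (Q : store -> Prop) := exists2 s', exec c s s' & Q s'.

Lemma runs_inc x s (Q : store -> Prop) :
  Q (upd s x (s x).+1) -> runs (Inc x) s Q.
Proof. by move=> h; exists (upd s x (s x).+1) => //; constructor. Qed.

Lemma runs_clr x s (Q : store -> Prop) : Q (upd s x 0) -> runs (Clr x) s Q.
Proof. by move=> h; exists (upd s x 0) => //; constructor. Qed.

Lemma runs_seq c d s Q : runs c s (fun s1 => runs d s1 Q) -> runs (Seq c d) s Q.
Proof. by case=> s1 h1 [s2 h2 q]; exists s2 => //; apply: exec_seq h1 h2. Qed.

Lemma runs_sub c s (Q Q' : store -> Prop) :
  runs c s Q -> (forall s', Q s' -> Q' s') -> runs c s Q'.
Proof. by case=> s' h q qq; exists s' => //; apply: qq. Qed.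

(** The index [k] counts the remaining rounds; it need not be the value of [x], which the body may
    overwrite. *)
Lemma runs_loop (I : nat -> store -> Prop) n x c s (Q : store -> Prop) :
    (forall k s1, I k.+1 s1 ->
       s1 x != 0 /\ runs c (upd s1 x (s1 x).-1) (I k)) ->
    (forall s1, I 0 s1 -> s1 x = 0 /\ Q s1) ->
  I n s -> runs (Loop x c) s Q.
Proof.
move=> hS h0; elim: n s => [|n IH] s.
  by case/h0=> sx q; exists s => //; constructor.
case/hS=> sx [s1 e1 /IH[s2 e2 q]]; exists s2 => //.
exact: exec_loopS e1 e2.
Qed.

(* [t] is a scratch register. *)
Definition copy x y t :=
  Seq (Clr y) (Seq (Clr t)
    (Seq (Loop x (Seq (Inc y) (Inc t))) (Loop t (Inc x)))).

Lemma runs_copy x y t s (Q : store -> Prop) : x != y -> x != t -> y != t ->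
    (forall s', s' y = s x -> (forall z, z != y -> z != t -> s' z = s z) -> Q s') ->
  runs (copy x y t) s Q.
Proof.
move=> xy xt yt hQ.
apply/runs_seq/runs_clr/runs_seq/runs_clr/runs_seq.
apply: (@runs_loop (fun k s1 => [/\ s1 x = k, s1 y + k = s x, s1 t + k = s x &
  forall z, z != x -> z != y -> z != t -> s1 z = s z]) (s x)).
- move=> k s1 [sx sy st sz]; rewrite sx; split=> //.
  apply/runs_seq/runs_inc/runs_inc; rewrite !updE !eqxx.
  rewrite (negbTE xy) (negbTE xt) (negbTE yt) !(eq_sym y) !(eq_sym t).
  rewrite (negbTE xy) (negbTE xt) (negbTE yt); split; try lia.
  by move=> z /negbTE zx /negbTE zy /negbTE zt;
    rewrite !updE zx zy zt sz ?zx ?zy ?zt.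
- move=> s1 [sx sy st sz]; split=> //.
  apply: (@runs_loop (fun k s1 => [/\ s1 t = k, s1 y = s x, s1 x + k = s x &
    forall z, z != x -> z != y -> z != t -> s1 z = s z]) (s x)).
  + move=> k s2 [s2t s2y s2x s2z]; rewrite s2t; split=> //.
    apply/runs_inc; rewrite !updE !eqxx (negbTE yt) !(eq_sym t) (eq_sym y).
    rewrite (negbTE xy) (negbTE xt); split; try lia.
    by move=> z /negbTE zx /negbTE zy /negbTE zt;
      rewrite !updE zx zt s2z ?zx ?zy ?zt.
  + move=> s2 [s2t s2y s2x s2z]; split=> //; apply: hQ => // z zy zt.
    by have [->|zx] := eqVneq z x; [lia | exact: s2z].
  + by split; try lia; exact: sz.
rewrite !updE !eqxx (negbTE xy) (negbTE xt) (negbTE yt); split=> //; try lia.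
by move=> z _ /negbTE zy /negbTE zt; rewrite !updE zy zt.
Qed.

(** * Compiling recursive functions into loop programs *)

(** The conclusion is a match on the code, so that case analysis on [eval] leads to no equation
    between dependent pairs. *)
Lemma eval_inv k (r : recf k) v y : eval r v y ->
  match r in recf k return Prop with
  | Rzero _ => y = 0
  | Rsucc => exists2 x, v = [:: x] & y = x.+1
  | Rproj _ i => y = nth 0 v i
  | Rcomp _ _ g hs => exists2 ws, evals hs v ws & eval g ws y
  | Rprec _ g h => exists n w, v = n :: w /\
      match n with
      | 0 => eval g w y
      | n'.+1 => exists2 z, eval (Rprec g h) (n' :: w) z &
                   eval h (n' :: z :: w) y
      end
  | Rmin _ g => eval g (y :: v) 0 /\
      forall z, z < y -> exists w, w <> 0 /\ eval g (z :: v) w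
  end.
Proof.
case=> //.
- by move=> x; exists x.
- by move=> k' m g hs v' ws y'; exists ws.
- by move=> k' g h v' y' e; exists 0, v'.
- by move=> k' g h n v' z y' e1 e2; exists n.+1, v'; split=> //; exists z.
Qed.

Lemma evals_inv k m (rs : recfs k m) v ys : evals rs v ys ->
  match rs in recfs k m return Prop with
  | Rnil _ => ys = [::]
  | Rcons _ _ f fs => exists y ws, [/\ ys = y :: ws, eval f v y & evals fs v ws]
  end.
Proof. by case=> // k' m' f fs v' y ys'; exists y, ys'. Qed.

(** The sequence [u] is the course of values of the recursion, to which the loop invariant of the
    compiled code refers. *)
Lemma eval_prec_inv k (g : recf k) (h : recf k.+2) n v y :
  eval (Rprec g h) (n :: v) y ->
  exists u : nat -> nat, [/\ u n = y, eval g v (u 0) &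
    forall i, i < n -> eval h (i :: u i :: v) (u i.+1)].
Proof.
elim: n y => [|n IH] y /eval_inv[_ [_ [[<- <-]]]]; first by exists (fun _ => y).
case=> z /IH[u [un u0 uS]] e; exists (upd u n.+1 y); split=> //.
  by rewrite updE eqxx.
move=> i; rewrite ltnS !updE eqSS => ilen; rewrite ltn_eqF ?ltnS //.
by have [->|ni] := eqVneq i n; [rewrite un | apply: uS; lia].
Qed.

(* The registers [args] hold the arguments, [out] receives the value, and the
   registers from [n] on are free scratch space. *)
Fixpoint comp k (r : recf k) (args : seq nat) (out n : nat) : cmd :=
  match r with
  | Rzero _ => Clr out
  | Rsucc => Seq (copy (nth 0 args 0) out n) (Inc out)
  | Rproj _ i => copy (nth 0 args i) out n
  | Rcomp k m g hs =>
      Seq (comps hs args n (n + m)) (comp g (iota n m) out (n + m))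
  | Rprec k g h =>
      let rest := behead args in
      Seq (copy (nth 0 args 0) n n.+3) (Seq (Clr n.+1)
        (Seq (comp g rest out n.+4)
          (Loop n (Seq (comp h (n.+1 :: out :: rest) n.+2 n.+4)
            (Seq (copy n.+2 out n.+3) (Inc n.+1))))))
  | Rmin k g =>
      Seq (Clr out) (Seq (comp g (out :: args) n n.+1)
        (Loop n (Seq (Inc out) (comp g (out :: args) n n.+1))))
  end
with comps k m (rs : recfs k m) (args : seq nat) (out n : nat) : cmd :=
  match rs with
  | Rnil _ => Clr n
  | Rcons k m f fs => Seq (comp f args out n) (comps fs args out.+1 n)
  end.

Scheme recf_mind := Induction for recf Sort Prop
with recfs_mind := Induction for recfs Sort Prop.

(** The frame condition keeps the arguments and the caller's registers intact while a subprogram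
    runs. *)
Definition computes k (r : recf k) := forall args out n s y,
  size args = k -> all (fun a => a < n) args -> out \notin args -> out < n ->
  eval r (map s args) y ->
  runs (comp r args out n) s
    (fun s' => s' out = y /\ forall z, z < n -> z != out -> s' z = s z).

(** The arguments lie below the block of results, so computing one result spoils neither the
    arguments nor the earlier results. *)
Definition computes_all k m (rs : recfs k m) := forall args out n s ys,
  size args = k -> all (fun a => a < out) args -> out + m <= n ->
  evals rs (map s args) ys ->
  runs (comps rs args out n) s
    (fun s' => map s' (iota out m) = ys /\ forall z, z < out -> s' z = s z).

Lemma map_agree (s s' : store) (l : seq nat) :
  (forall z, z \in l -> s z = s' z) -> map s l = map s' l.
Proof. by move=> h; apply/eq_in_map. Qed.

Lemma nth_lt_args k (args : seq nat) n i : size args = k -> i < k ->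
  all (fun a => a < n) args -> nth 0 args i < n /\ nth 0 args i \in args.
Proof.
by move=> sz ik /allP h; have hm := mem_nth 0 (s := args) (n := i);
  rewrite sz in hm; split; [apply: h|]; exact: hm.
Qed.

(** Register [n] counts the remaining rounds, [n.+1] holds the index, [n.+2] receives the next term,
    [n.+3] is scratch, and [out] holds the current term of [u]. *)
Lemma computes_prec k (g : recf k) (h : recf k.+2) :
  computes g -> computes h -> computes (Rprec g h).
Proof.
move=> IHg IHh [//|a args] out n s y /= [sz] /andP[an hall].
rewrite inE negb_or => /andP[oa oargs] on.
case/eval_prec_inv=> u [uy ev0 evS].
have ltargs z : z \in args -> z < n by move/allP: hall; apply.
have nargs j : n + j \notin args by apply/negP => /ltargs; lia.
apply/runs_seq/runs_copy; try lia.
move=> s1 s1n s1z; apply/runs_seq/runs_clr/runs_seq.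
set s2 := upd s1 _ _.
have s2z z : z < n -> s2 z = s z by move=> zn; rewrite /s2 updE ifF ?s1z //; lia.
apply: runs_sub (IHg args out n.+4 s2 (u 0) sz _ oargs _ _) _.
- by apply/allP => z /ltargs; lia.
- lia.
- by rewrite (@map_agree _ s) // => z /ltargs; apply: s2z.
move=> s3 [s3o s3z].
apply: (@runs_loop (fun k s' => [/\ s' n = k, s' n.+1 + k = s a,
  s' out = u (s' n.+1) & forall z, z < n -> z != out -> s' z = s z]) (s a)).
- move=> i s4 [s4n s4i s4o s4z]; rewrite s4n; split=> //; apply: runs_seq.
  set s5 := upd s4 _ _.
  apply: runs_sub (IHh (n.+1 :: out :: args) n.+2 n.+4 s5 (u (s4 n.+1).+1) _ _ _ _ _) _.
  + by rewrite /= sz.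
  + rewrite /=; apply/and3P; split; try lia.
    by apply/allP => z /ltargs; lia.
  + rewrite !inE !negb_or -(addn2 n) nargs; apply/and3P; split=> //; lia.
  + lia.
  + rewrite /= {1 2}/s5 !updE ifF ?ifF; try lia.
    rewrite s4o (@map_agree _ s); first by apply: evS; lia.
    move=> z zargs; have zn := ltargs _ zargs.
    rewrite /s5 updE ifF ?s4z //; try lia.
    by apply: contraNneq oargs => <-.
  move=> s6 [s6r s6z].
  apply/runs_seq/runs_copy; try lia.
  move=> s7 s7o s7z; apply: runs_inc.
  have s7n : s7 n = i by rewrite s7z ?s6z ?/s5 ?updE ?eqxx ?s4n //; lia.
  have s7i : s7 n.+1 = s4 n.+1 by rewrite s7z ?s6z ?/s5 ?updE ?ifF //; lia.
  have outn : (out == n.+1) = false by lia.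
  rewrite !updE eqxx outn ifF ?s7n ?s7i ?s7o ?s6r; try lia.
  split=> //; try lia.
  move=> z zn zo; rewrite updE ifF ?s7z ?s6z; try lia.
  by rewrite /s5 updE ifF ?s4z //; lia.
- by move=> s4 [s4n s4i s4o s4z]; split=> //; split=> //; rewrite s4o -uy; congr u; lia.
have e2 : s3 n = s a.
  by rewrite s3z ?/s2 ?updE ?ifF ?s1n //; lia.
have e3 : s3 n.+1 = 0.
  by rewrite s3z ?/s2 ?updE ?eqxx //; lia.
rewrite e2 e3 s3o; split=> // z zn zo; rewrite s3z; try lia.
exact: s2z.
Qed.

Lemma computes_min k (g : recf k.+1) : computes g -> computes (Rmin g).
Proof.
move=> IH args out n s y sz hall oargs on /eval_inv[ev0 evlt] /=.
have ltargs z : z \in args -> z < n by move/allP: hall; apply.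
have step s1 i w : s1 out = i -> (forall z, z < n -> z != out -> s1 z = s z) ->
    eval g (i :: map s args) w ->
    runs (comp g (out :: args) n n.+1) s1 (fun s' => [/\ s' n = w, s' out = i
      & forall z, z < n -> z != out -> s' z = s z]).
  move=> s1o s1z ev.
  apply: runs_sub (IH (out :: args) n n.+1 s1 w _ _ _ _ _) _ => //=.
  + by rewrite sz.
  + rewrite ltnS ltnW //; apply/allP => z /ltargs; lia.
  + rewrite inE negb_or; apply/andP; split; first lia.
    by apply/negP => /ltargs; lia.
  + rewrite s1o (@map_agree _ s) // => z zargs; apply: s1z; first exact: ltargs.
    by apply: contraNneq oargs => <-.
  move=> s2 [s2n s2z]; split=> //; first by rewrite s2z -?s1o //; lia.
  by move=> z zn zo; rewrite s2z ?s1z //; lia.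
have [w [ev hw]] : exists w, eval g (0 :: map s args) w /\ (w == 0) = (y == 0).
  case: (y) ev0 evlt => [|y'] ev0 evlt; first by exists 0.
  by have [//|w [/eqP/negbTE wn ev]] := evlt 0; exists w.
apply/runs_seq/runs_clr/runs_seq.
apply: runs_sub (step _ 0 w _ _ ev) _.
- by rewrite updE eqxx.
- by move=> z zn /negbTE zo; rewrite updE zo.
move=> s1 [s1n s1o s1z].
(* Register [n] holds the value of [g] at [out]. Its decrement is harmless, because the body
   overwrites it: only its vanishing matters, and the number of rounds left is the distance from
   [out] to [y]. *)
apply: (@runs_loop (fun k s' => [/\ (s' n == 0) = (k == 0), s' out + k = y &
  forall z, z < n -> z != out -> s' z = s z]) y).
- move=> i s2 [s2n s2o s2z]; split; first by rewrite s2n.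
  have [w' [ev' hw']] : exists w, eval g ((s2 out).+1 :: map s args) w /\
      (w == 0) = (i == 0).
    have [i0|i0] := eqVneq i 0; first by exists 0; split=> //; have -> : (s2 out).+1 = y by lia.
    have [|w' [/eqP/negbTE wn ev']] := evlt (s2 out).+1; first by lia.
    by exists w'.
  apply/runs_seq/runs_inc; apply: runs_sub (step _ (s2 out).+1 w' _ _ ev') _.
  + by rewrite !updE eqxx; case: eqP; lia.
  + move=> z zn zo; rewrite !updE (negbTE zo) ifF ?s2z //; lia.
  by move=> s3 [s3n s3o s3z]; rewrite s3n s3o; split=> //; lia.
- move=> s2 [s2n s2o s2z]; split; first by apply/eqP; rewrite s2n.
  by split=> //; lia.
by rewrite s1n s1o.
Qed.

Lemma comp_correct k (r : recf k) : computes r.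
Proof.
apply: (@recf_mind computes computes_all) => {k r}.
- move=> k args out n s y sz hall oargs on /eval_inv -> /=.
  apply: runs_clr; rewrite updE eqxx; split=> // z _ /negbTE zo.
  by rewrite updE zo.
- move=> [//|a []//] out n s y _ /=; rewrite andbT inE => an oa on.
  case/eval_inv=> _ [<-] ->; apply/runs_seq/runs_copy; try lia.
  move=> s1 s1o s1z; apply: runs_inc; rewrite updE eqxx s1o; split=> //.
  by move=> z zn /negbTE zo; rewrite updE zo s1z ?zo //; lia.
- move=> k i args out n s y sz hall oargs on /eval_inv -> /=.
  have [an am] := nth_lt_args sz (ltn_ord i) hall.
  apply: runs_copy; try lia.
    by apply: contraNneq oargs => <-.
  move=> s1 s1o s1z; rewrite s1o (nth_map 0) ?sz //; split=> //.
  by move=> z zn zo; rewrite s1z //; lia.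
- move=> k m g IHg hs IHh args out n s y sz hall oargs on.
  case/eval_inv=> ws evh evg /=; apply: runs_seq.
  apply: runs_sub (IHh args n (n + m) s ws sz hall (leqnn _) evh) _.
  move=> s1 [s1w s1z].
  apply: runs_sub (IHg (iota n m) out (n + m) s1 y (size_iota _ _) _ _ _ _) _.
  + by apply/allP => z; rewrite mem_iota => /andP[].
  + by rewrite mem_iota; lia.
  + lia.
  + by rewrite s1w.
  by move=> s2 [s2o s2z]; split=> // z zn zo; rewrite s2z ?s1z //; lia.
- by move=> k g IHg h IHh; apply: computes_prec.
- by move=> k g IHg; apply: computes_min.
- move=> k args out n s ys sz hall on /evals_inv -> /=; apply: runs_clr.
  by split=> // z zo; rewrite updE ifF //; lia.
- move=> k m f IHf fs IHfs args out n s ys sz hall on.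
  case/evals_inv=> y [ws [-> evf evfs]] /=; apply: runs_seq.
  have ltargs z : z \in args -> z < out by move/allP: hall; apply.
  apply: runs_sub (IHf args out n s y sz _ _ _ evf) _.
  + by apply/allP => z /ltargs; lia.
  + by apply/negP => /ltargs; lia.
  + lia.
  move=> s1 [s1o s1z].
  apply: runs_sub (IHfs args out.+1 n s1 ws sz _ _ _) _.
  + by apply/allP => z /ltargs; lia.
  + lia.
  + by rewrite (@map_agree _ s) // => z /ltargs zo; apply: s1z; lia.
  move=> s2 [<- s2z]; rewrite s2z // s1o; split=> // z zo.
  by rewrite s2z ?s1z //; lia.
Qed.

(** * Summing a recursive function below a power of two *)

Definition dbl := Seq (Loop 0 (Seq (Inc 1) (Inc 1))) (Loop 1 (Inc 0)).

Fixpoint pow2 N := if N is N'.+1 then Seq (pow2 N') dbl else Inc 0.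

Lemma runs_pow2 N :
  runs (pow2 N) (fun _ => 0) (fun s => s 0 = 2 ^ N /\ forall z, 0 < z -> s z = 0).
Proof.
elim: N => [|N IH] /=; first by apply: runs_inc; split=> // -[].
apply/runs_seq/(runs_sub IH) => s [s0 sz]; apply: runs_seq.
apply: (@runs_loop (fun k s1 => [/\ s1 0 = k, s1 1 + k.*2 = 2 ^ N.+1 &
  forall z, 1 < z -> s1 z = 0]) (2 ^ N)).
- move=> k s1 [-> s11 s1z]; split=> //; apply/runs_seq/runs_inc/runs_inc.
  rewrite !updE /=; split=> //; first lia.
  by move=> [|[|z]] // _; apply: s1z.
- move=> s1 [s10 s11 s1z]; split=> //.
  apply: (@runs_loop (fun k s1 => [/\ s1 1 = k, s1 0 + k = 2 ^ N.+1 &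
    forall z, 1 < z -> s1 z = 0]) (2 ^ N.+1)).
  + move=> k s2 [-> s20 s2z]; split=> //; apply/runs_inc.
    rewrite !updE /=; split=> //; first lia.
    by move=> [|[|z]] // _; apply: s2z.
  + move=> s2 [s21 s20 s2z]; split=> //; split; first lia.
    by move=> [|[|z]] // _; apply: s2z.
  by split=> //; lia.
split=> //; last by move=> z z1; apply: sz; lia.
by rewrite sz // expnS; lia.
Qed.

(** Register 0 is the loop index, 1 the argument of [r], 2 its value and 3 the running sum; the
    registers from 4 on are scratch. *)
Definition sum_below (r : recf 1) N :=
  Seq (pow2 N) (Loop 0 (Seq (copy 0 1 4)
    (Seq (comp r [:: 1] 2 5) (Loop 2 (Inc 3))))).

Lemma runs_sum_below (r : recf 1) (f : nat -> nat) N :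
    (forall n, eval r [:: n] (f n)) ->
  runs (sum_below r N) (fun _ => 0) (fun s => forall i, i < 2 ^ N -> f i <= s 3).
Proof.
move=> ev; apply/runs_seq/(runs_sub (runs_pow2 N)) => s [s0 sz].
(* The index is decremented before the body runs, so the arguments go from [2 ^ N - 1] down to 0. *)
apply: (@runs_loop (fun k s1 => s1 0 = k /\
  forall i, k <= i < 2 ^ N -> f i <= s1 3) (2 ^ N)).
- move=> k s1 [s10 s1f]; rewrite s10; split=> //.
  apply/runs_seq/runs_copy => // s2; rewrite updE eqxx /= => s21 s2z.
  apply: runs_seq; apply: runs_sub (@comp_correct _ r [:: 1] 2 5 s2 (f k) _ _ _ _ _) _ => //.
    by rewrite /= s21.
  move=> s3 [s32 s3z].
  have s30 : s3 0 = k by rewrite s3z ?s2z.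
  have s33 : s3 3 = s1 3 by rewrite s3z ?s2z.
  apply: (@runs_loop (fun j s4 => [/\ s4 2 = j, s4 0 = k & s4 3 + j = s1 3 + f k])
    (f k)).
  + move=> j s4 [-> s40 s43]; split=> //; apply: runs_inc.
    by rewrite !updE /=; split=> //; lia.
  + move=> s4 [s42 s40 s43]; split=> //; split=> // i /andP[].
    rewrite leq_eqVlt => /orP[/eqP <- _|ki iN]; first by lia.
    by have := s1f i; rewrite ki iN => /(_ isT); lia.
  by rewrite s33.
- by move=> s1 [s10 s1f]; split.
by split=> // i; case: leqP.
Qed.

(** * Counter machines *)

Inductive instr :=
| IInc of nat & nat
| IDec of nat & nat & nat.

Notation config := (nat * store)%type.

Definition step (P : seq instr) (a : config) : config :=
  match onth P a.1 with
  | Some (IInc x q) => (q, upd a.2 x (a.2 x).+1)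
  | Some (IDec x q1 q2) =>
      if a.2 x == 0 then (q2, a.2) else (q1, upd a.2 x (a.2 x).-1)
  | None => a
  end.

Definition conf P i : config := iter i (step P) (0, fun _ => 0).

Fixpoint csize c :=
  match c with
  | Inc _ | Clr _ => 1
  | Seq c d => csize c + csize d
  | Loop _ c => (csize c).+1
  end.

(* Code for [c] placed at address [p] and continuing at address [e]. *)
Fixpoint flat c p e : seq instr :=
  match c with
  | Inc x => [:: IInc x e]
  | Clr x => [:: IDec x p e]
  | Seq c d => flat c p (p + csize c) ++ flat d (p + csize c) e
  | Loop x c => IDec x p.+1 e :: flat c p.+1 p
  end.

Lemma size_flat c p e : size (flat c p e) = csize c.
Proof.
by elim: c p e => //= [c IHc d IHd|x c IHc] p e; rewrite ?size_cat ?IHc ?IHd.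
Qed.

Lemma onth_at (A B : seq instr) a p : size A = p -> onth (A ++ a :: B) p = Some a.
Proof. by move=> <-; elim: A. Qed.

(** Arbitrary code [A] and [B] around the block lets the induction on the execution pass to
    subcommands. *)
Lemma flat_exec c s s' : exec c s s' -> forall P p e A B,
  P = A ++ flat c p e ++ B -> size A = p ->
  exists n, iter n (step P) (p, s) = (e, s').
Proof.
elim=> {c s s'}.
- move=> x s P p e A B PE szA; exists 1 => /=.
  by rewrite /step PE /= onth_at.
- move=> x s P p e A B PE szA.
  have onP : onth P p = Some (IDec x p e) by rewrite PE /= onth_at.
  (* [Clr] is a single instruction that decrements and jumps to itself, hence an inner induction on
     the value of [x]. *)
  have [n sx] : exists n, s x = n by exists (s x).
  elim: n s sx => [|n IH] s sx.
    exists 1; rewrite /= /step /= onP sx eqxx; congr pair.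
    by rewrite -sx upd_same.
  have [|k kE] := IH (upd s x n); first by rewrite updE eqxx.
  exists k.+1; rewrite iterSr [step P _]/step /= onP sx /= kE.
  by rewrite upd_upd.
- move=> c d s s1 s2 _ IHc _ IHd P p e A B PE szA.
  have [n1 E1] := IHc P p (p + csize c) A (flat d (p + csize c) e ++ B)
    ltac:(by rewrite PE /= -catA) szA.
  have [n2 E2] := IHd P (p + csize c) e (A ++ flat c p (p + csize c)) B
    ltac:(by rewrite PE /= -!catA) ltac:(by rewrite size_cat size_flat szA).
  by exists (n2 + n1); rewrite iterD E1.
- move=> x c s sx P p e A B PE szA; exists 1.
  by rewrite /= /step PE /= onth_at //= sx eqxx.
- move=> x c s s1 s2 /negbTE sx _ IHc _ IHl P p e A B PE szA.
  have [n1 E1] := IHc P p.+1 p (rcons A (IDec x p.+1 e)) B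
    ltac:(by rewrite PE cat_rcons) ltac:(by rewrite size_rcons szA).
  have [n2 E2] := IHl P p e A B PE szA.
  exists (n2 + n1.+1); rewrite iterD iterSr.
  have onP : onth P p = Some (IDec x p.+1 e) by rewrite PE /= onth_at.
  by rewrite [step P _]/step /= onP sx E1.
Qed.

Definition wf_instr K S (a : instr) :=
  match a with
  | IInc x q => (x < K) && (q <= S)
  | IDec x q1 q2 => [&& x < K, q1 <= S & q2 <= S]
  end.

Fixpoint regs_below K c :=
  match c with
  | Inc x | Clr x => x < K
  | Seq c d => regs_below K c && regs_below K d
  | Loop x c => (x < K) && regs_below K c
  end.

Lemma regs_below_mono K K' c : K <= K' -> regs_below K c -> regs_below K' c.
Proof.
by move=> KK; elim: c => /= [x|x|c IHc d IHd|x c IHc]; lia.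
Qed.

Lemma regs_belowP c : exists K, regs_below K c.
Proof.
elim: c => [x|x|c [K1 h1] d [K2 h2]|x c [K h]].
- by exists x.+1 => /=.
- by exists x.+1 => /=.
- exists (maxn K1 K2) => /=; apply/andP; split.
    by apply: regs_below_mono h1; lia.
  by apply: regs_below_mono h2; lia.
- exists (maxn x.+1 K) => /=; apply/andP; split; first lia.
  by apply: regs_below_mono h; lia.
Qed.

Lemma wf_flat K S c p e : regs_below K c -> p + csize c <= S -> e <= S ->
  all (wf_instr K S) (flat c p e).
Proof.
elim: c p e => /= [x|x|c IHc d IHd|x c IHc] p e; try lia.
  case/andP=> hc hd pS eS; rewrite all_cat IHc ?IHd //; lia.
by case/andP=> xK hc pS eS; rewrite IHc //; lia.
Qed.

Lemma onth_size (P : seq instr) q : q < size P -> exists a, onth P q = Some a.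
Proof. by elim: P q => //= a P IH [_|q /IH //]; exists a. Qed.

Lemma onth_all (p : pred instr) P q a : all p P -> onth P q = Some a -> p a.
Proof.
elim: P q => [|b P IH] [|q] //= /andP[pb hP]; first by case=> <-.
exact: IH.
Qed.

Lemma onth_oversize (P : seq instr) q : size P <= q -> onth P q = None.
Proof. by elim: P q => [|a P IH] [|q] //=; apply: IH. Qed.

(** [K] and [C] do not depend on [N]: a larger [N] only repeats [dbl], which has constant size and
    fixed registers. *)
Lemma general_recursive_machine f : general_recursive f ->
  exists K C, forall N, exists P T,
    [/\ size P <= C + C * N, all (wf_instr K (size P)) P,
        (conf P T).1 = size P, forall i, i < T -> (conf P i).1 < size P &
        forall i, i < 2 ^ N -> exists x, f i <= (conf P T).2 x].
Proof.
case=> r ev.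
(* The instance [N = 1] already contains [dbl], so it shows every register that any other [N]
   uses. *)
have [K hK] := regs_belowP (sum_below r 1).
exists K, (csize (sum_below r 1)) => N.
set c := sum_below r N; set P := flat c 0 (csize c).
have szP : size P = csize c by rewrite size_flat.
have [s' ex hs'] := runs_sum_below N ev.
have [n E] := flat_exec ex (P := P) (p := 0) (e := csize c) (A := [::]) (B := [::])
  ltac:(by rewrite /= cats0) erefl.
have halts : exists n, (conf P n).1 >= size P by exists n; rewrite /conf E szP.
(* [T] is the first halting time. A halted configuration never changes, so the store at [T] is the
   final store of the program. *)
have [T hT Tmin] := ex_minnP halts.
have haltS k : conf P (T + k) = conf P T.
  elim: k => [|k IH]; first by rewrite addn0.
  by rewrite addnS /conf iterS -/(conf P (T + k)) IH /step onth_oversize.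
have ET : conf P T = (size P, s').
  by rewrite szP -E -(haltS (n - T)) subnKC // Tmin // /conf E szP.
exists P, T; split.
- have dblS : csize (pow2 N) <= 1 + 7 * N.
    by elim: (N) => //= m IH; rewrite mulnS; lia.
  rewrite szP /c /=; nia.
- rewrite szP; apply: wf_flat => //.
  move: hK; rewrite /c /= => /andP[h1 ->]; rewrite andbT.
  by elim: (N) => [|m IH] /=; [case/andP: h1 | rewrite IH; case/andP: h1].
- by rewrite ET.
- by move=> i iT; rewrite ltnNge; apply/negP => /Tmin; lia.
- by move=> i /hs' h; exists 3; rewrite ET.
Qed.

(** * The sentence describing a machine *)

(* Variables [0] to [9] are local (variable [0] names the initial time);
   [cv i] is the variable of the [i]-th colour vertex. *)
Notation cv i := (i.+4.+4.+2).

Definition FTrue := FEq 0 0.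
Definition FFalse := FNeg FTrue.

(** These are locked against unfolding by simplification. Both end in a constant built on [FEq 0 0],
    so variable 0 occurs in them. *)
HB.lock Definition bigAnd n (F : nat -> form) := foldr (fun i => FAnd (F i)) FTrue (iota 0 n).
HB.lock Definition bigOr n (F : nat -> form) := foldr (fun i => FOr (F i)) FFalse (iota 0 n).

Fixpoint exs n B := if n is n'.+1 then FEx (cv n') (exs n' B) else B.

Definition NAdj x y := FNeg (FAdj x y).
Definition NEq x y := FNeg (FEq x y).

Section Formula.

Variables (K : nat) (P : seq instr).

(* Colours below [nreg] are the clock [0] and the registers (register [x] has
   colour [x.+1]); colour [nreg + q] is the state [q]. *)
Let nreg := K.+1.
Let ncol := nreg + (size P).+1.
Let cst q := cv (nreg + q).

(** Apart from edges at colour vertices, the last conjunct leaves only edges between times and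
    register elements. *)
Definition Fpair i j :=
  FAnd (if i == j then FTrue else NEq (cv i) (cv j))
  (FAnd (NAdj (cv i) (cv j))
  (FAnd (if i == j then FTrue else FOr (NAdj 1 (cv i)) (NAdj 1 (cv j)))
     (if (i < nreg) == (j < nreg)
      then FOr (NAdj 1 (cv i)) (FOr (NAdj 2 (cv j)) (NAdj 1 2))
      else FTrue))).

Definition Fpairs :=
  FAll 1 (FAll 2 (bigAnd ncol (fun i => bigAnd ncol (Fpair i)))).

Definition Fcoloured :=
  FAll 1 (bigOr ncol (fun i => FOr (FEq 1 (cv i)) (FAdj 1 (cv i)))).

(** Comparability under inclusion is stated by forbidding a crossing pair: 3 adjacent to 1 only, 4
    adjacent to 2 only. This needs universal quantifiers alone. *)
Definition Fchain :=
  FAll 1 (FAll 2 (FAll 3 (FAll 4 (bigAnd nreg (fun j =>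
    FOr (NAdj 3 (cv j)) (FOr (NAdj 4 (cv j)) (FOr (NAdj 3 1)
      (FOr (FAdj 3 2) (FOr (FAdj 4 1) (NAdj 4 2)))))))))).

Definition Fnotime x := bigAnd (size P).+1 (fun q => NAdj x (cst q)).

Definition Fextensional :=
  FAll 1 (FAll 2 (FOr (Fnotime 1) (FOr (Fnotime 2) (FOr (FEq 1 2)
    (FEx 3 (FAnd (FAdj 3 (cv 0))
      (FOr (FAnd (FAdj 3 1) (NAdj 3 2)) (FAnd (NAdj 3 1) (FAdj 3 2))))))))).

(** This excludes stray elements that belong to no time; the colour vertex itself does not count as
    a witness. *)
Definition Fcovered :=
  FAll 3 (bigAnd nreg (fun j =>
    FOr (NAdj 3 (cv j)) (FEx 1 (FAnd (FAdj 1 3) (NEq 1 (cv j)))))).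

Definition Fstart := FAnd (FAdj 0 (cst 0)) (FAll 1 (FOr (NAdj 1 0) (FEq 1 (cst 0)))).

Definition Fhalt :=
  FAll 1 (FOr (NAdj 1 (cst (size P))) (FAll 3 (FOr (NAdj 3 (cv 0)) (FAdj 3 1)))).

(* [2] is the time after [1]: their neighbourhoods differ only in their states,
   in the clock element [3], and in [4], whose role is described by [B]. *)
Definition Fmove q q' B :=
  FEx 2 (FEx 3 (FEx 4 (FAnd (FAdj 2 (cst q')) (FAnd (FAdj 3 (cv 0))
    (FAnd (NAdj 3 1) (FAnd (FAdj 3 2) (FAnd B
      (FAll 5 (FOr (FEq 5 3) (FOr (FEq 5 4) (FOr (FEq 5 (cst q)) (FOr (FEq 5 (cst q'))
        (FOr (FAnd (FAdj 5 1) (FAdj 5 2)) (FAnd (NAdj 5 1) (NAdj 5 2))))))))))))))).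

Definition Finc j := FAnd (FAdj 4 (cv j)) (FAnd (NAdj 4 1) (FAdj 4 2)).
Definition Fdec j := FAnd (FAdj 4 (cv j)) (FAnd (FAdj 4 1) (NAdj 4 2)).
(** A zero test changes no register, so variable 4 receives the clock element 3 as a dummy value. *)
Definition Ftst j := FAnd (FEq 4 3) (FAll 5 (FOr (NAdj 5 (cv j)) (NAdj 5 1))).

Definition Finstr q :=
  match onth P q with
  | Some (IInc x q') => Fmove q q' (Finc x.+1)
  | Some (IDec x q1 q2) => FOr (Fmove q q1 (Fdec x.+1)) (Fmove q q2 (Ftst x.+1))
  | None => FTrue
  end.

Definition Fstep :=
  FAll 1 (bigAnd (size P) (fun q => FOr (NAdj 1 (cst q)) (Finstr q))).

Definition Fbody :=
  FAnd Fpairs (FAnd Fcoloured (FAnd Fchain (FAnd Fextensional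
    (FAnd Fcovered (FAnd Fstart (FAnd Fhalt Fstep)))))).

Definition Fmachine := FEx 0 (exs ncol Fbody).

End Formula.

(** * Satisfaction of the sentence as conditions on a graph *)

Section Satisfaction.

Variable G : graph.
Implicit Types env : nat -> vert G.

Lemma sat_bigAnd env n F : sat env (bigAnd n F) <-> forall i, i < n -> sat env (F i).
Proof.
rewrite bigAnd.unlock; have -> : (forall i, i < n -> sat env (F i)) <->
    (forall i, i \in iota 0 n -> sat env (F i)).
  by split=> h i; have := h i; rewrite mem_iota.
elim: (iota 0 n) => [|a l IH] /=; first by [].
split=> [[ha /IH hl] i|h].
  by rewrite inE => /orP[/eqP ->|/hl].
by split; [apply: h; rewrite mem_head | apply/IH => i il; apply: h; rewrite inE il orbT].
Qed.

Lemma sat_bigOr env n F :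
  sat env (bigOr n F) <-> exists2 i, i < n & sat env (F i).
Proof.
rewrite bigOr.unlock; have -> : (exists2 i, i < n & sat env (F i)) <->
    (exists2 i, i \in iota 0 n & sat env (F i)).
  by split=> -[i]; rewrite ?mem_iota => h s; exists i; rewrite ?mem_iota.
elim: (iota 0 n) => [|a l IH] /=; first by split=> // -[].
split=> [[h|/IH[i il h]]|[i]].
- by exists a; rewrite ?mem_head.
- by exists i; rewrite // inE il orbT.
- by rewrite inE => /orP[/eqP ->|il] h; [left | right; apply/IH; exists i].
Qed.

Lemma sat_FAll env x B v : sat env (FAll x B) -> sat (upd env x v) B.
Proof. exact. Qed.

Lemma FAll_sat env x B : (forall v, sat (upd env x v) B) -> sat env (FAll x B).
Proof. exact. Qed.

Lemma sat_exs env n B : sat env (exs n B) -> exists env', sat env' B.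
Proof. by elim: n env => [|n IH] env /=; [exists env | case=> v /IH]. Qed.

Lemma exs_sat env n B : sat env B -> sat env (exs n B).
Proof. by move=> h; elim: n => //= n IH; exists (env (cv n)); rewrite upd_same. Qed.

End Satisfaction.

Section Model.

Variables (K : nat) (P : seq instr) (V : Type) (adj : V -> V -> Prop).
Variables (t0 : V) (c : nat -> V).
Let nreg := K.+1.
Let ncol := nreg + (size P).+1.

Definition move_model q q' (B : V -> V -> V -> V -> Prop) t t' :=
  exists x0 x, [/\ adj t' (c (nreg + q')), adj x0 (c 0), ~ adj x0 t, adj x0 t'
    & B t t' x0 x /\ forall y, y = x0 \/ y = x \/ y = c (nreg + q) \/
        y = c (nreg + q') \/ (adj y t /\ adj y t' \/ ~ adj y t /\ ~ adj y t')].

Definition inc_model j t t' (x0 x : V) := adj x (c j) /\ ~ adj x t /\ adj x t'.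
Definition dec_model j t t' (x0 x : V) := adj x (c j) /\ adj x t /\ ~ adj x t'.
Definition tst_model j t (t' x0 x : V) :=
  x = x0 /\ forall y, ~ adj y (c j) \/ ~ adj y t.

Definition instr_model q a t t' :=
  match a with
  | IInc x q' => move_model q q' (inc_model x.+1) t t'
  | IDec x q1 q2 =>
      move_model q q1 (dec_model x.+1) t t' \/ move_model q q2 (tst_model x.+1) t t'
  end.

Definition time t := exists2 q, q <= size P & adj t (c (nreg + q)).

Record model : Prop := Model {
  mod_neq : forall i j, i < ncol -> j < ncol -> i != j -> c i <> c j;
  mod_cc : forall i j, i < ncol -> j < ncol -> ~ adj (c i) (c j);
  mod_uniq : forall i j x, i < ncol -> j < ncol -> adj x (c i) -> adj x (c j) -> i = j;
  mod_side : forall i j x y, i < ncol -> j < ncol -> (i < nreg) = (j < nreg) ->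
    adj x (c i) -> adj y (c j) -> ~ adj x y;
  mod_col : forall x, exists2 i, i < ncol & x = c i \/ adj x (c i);
  mod_chain : forall j t t' x y, j < nreg -> adj x (c j) -> adj y (c j) ->
    adj x t -> adj y t' -> adj x t' \/ adj y t;
  mod_ext : forall t t', time t -> time t' -> t = t' \/ exists2 x, adj x (c 0) &
    adj x t /\ ~ adj x t' \/ ~ adj x t /\ adj x t';
  mod_cov : forall j x, j < nreg -> adj x (c j) -> exists2 t, adj t x & t <> c j;
  mod_start : adj t0 (c nreg) /\ forall x, adj x t0 -> x = c nreg;
  mod_halt : forall t x, adj t (c (nreg + size P)) -> adj x (c 0) -> adj x t;
  mod_step : forall q a t, onth P q = Some a -> adj t (c (nreg + q)) ->
    exists t', instr_model q a t t'
}.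

End Model.

Lemma sat_Fbody K P (G : graph) (env : nat -> vert G) :
  sat env (Fbody K P) <->
    sat env (Fpairs K P) /\ sat env (Fcoloured K P) /\ sat env (Fchain K) /\
    sat env (Fextensional K P) /\ sat env (Fcovered K) /\ sat env (Fstart K) /\
    sat env (Fhalt K P) /\ sat env (Fstep K P).
Proof. by []. Qed.

(** Negation normal form writes every implication as a disjunction; the converse direction chooses
    the disjunct by excluded middle. *)
Lemma sat_model K P (G : graph) (env : nat -> vert G) :
  sat env (Fbody K P) <-> model K P (@adj G) (env 0) (fun i => env (cv i)).
Proof.
have notime x t e : e x = t -> (forall i, e (cv i) = env (cv i)) ->
    sat e (Fnotime K P x) <-> ~ time K P (@adj G) (fun i => env (cv i)) t.
  move=> ex ec; rewrite sat_bigAnd /=; split=> h.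
    by case=> q qs; rewrite -ec -ex; apply: h.
  by move=> q qs tq; apply: h; exists q => //; rewrite -ec -ex.
split.
- case/sat_Fbody=> hpair [hcol [hchain [hext [hcov [hstart [hhalt hstep]]]]]].
  have {}hpair x y i (hi : i < K.+1 + (size P).+1) j (hj : j < K.+1 + (size P).+1) :
      sat (upd (upd env 1 x) 2 y) (Fpair K i j).
    move/(sat_FAll x)/(sat_FAll y)/sat_bigAnd: hpair => /(_ i hi).
    by move/sat_bigAnd/(_ j hj).
  split.
  + move=> i j hi hj /negbTE ij; have [] := hpair (env 0) (env 0) i hi j hj.
    by rewrite ij.
  + by move=> i j hi hj; have [_ []] := hpair (env 0) (env 0) i hi j hj.
  + move=> i j x hi hj xi xj; have [_ [_ []]] := hpair x (env 0) i hi j hj.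
    by have [//|_] := eqVneq i j; case.
  + move=> i j x y hi hj ij xi yj; have [_ [_ [_]]] := hpair x y i hi j hj.
    by rewrite ij eqxx /=; case=> // -[].
  + move=> x; have /sat_bigOr[i hi h] := sat_FAll x hcol.
    by exists i.
  + move=> j t t' x y hj xj yj xt yt'.
    have /sat_bigAnd/(_ j hj) /= := sat_FAll y (sat_FAll x (sat_FAll t' (sat_FAll t hchain))).
    by case=> [|[|[|[|[|]]]]] //; [left | right].
  + move=> t t' ht ht'; have := sat_FAll t' (sat_FAll t hext).
    case=> [|[|[|]]].
    * by move/(notime 1 t) => /(_ erefl (fun i => erefl)).
    * by move/(notime 2 t') => /(_ erefl (fun i => erefl)).
    * by left.
    * by case=> x [x0 h]; right; exists x.
  + move=> j x hj xj; have /sat_bigAnd/(_ j hj) /= := sat_FAll x hcov.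
    by case=> // -[t [tx tj]]; exists t.
  + case: hstart => /= hs1 hs2; split; first by move: hs1; rewrite addn0.
    by move=> x xt; have := hs2 x; rewrite addn0; case.
  + by move=> t x ts x0; have /= := hhalt t; case=> // /(_ x) [].
  + move=> q a t onP tq; have qP : q < size P.
      by rewrite ltnNge; apply/negP => /onth_oversize; rewrite onP.
    have /sat_bigAnd/(_ q qP) := sat_FAll t hstep.
    case=> [/(_ tq) //|]; rewrite /Finstr onP; case: a {onP} => [x q'|x q1 q2] /=.
      case=> t' [x0 [x1 [h1 [h2 [h3 [h4 [h5 h6]]]]]]].
      by exists t', x0, x1.
    by case=> -[t' [x0 [x1 [h1 [h2 [h3 [h4 [h5 h6]]]]]]]]; exists t'; [left|right];
      exists x0, x1.
- case=> mneq mcc muniq mside mcol mchain mext mcov [ms1 ms2] mhalt mstep.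
  apply/sat_Fbody; refine (conj _ (conj _ (conj _ (conj _ (conj _ (conj _ (conj _ _))))))).
  + apply: FAll_sat => x; apply: FAll_sat => y.
    apply/sat_bigAnd => i hi; apply/sat_bigAnd => j hj.
    split; first by have [//|ij] := eqVneq i j; exact: mneq hi hj ij.
    split; first exact: mcc.
    split.
      have [//|/eqP ij] := eqVneq i j.
      have [xi|xi] := classic (@adj G x (env (cv i))); last by left.
      by right=> xj; apply: ij; apply: muniq xi xj.
    case: eqP => // ij.
    have [xi|xi] := classic (@adj G x (env (cv i))); last by left.
    have [yj|yj] := classic (@adj G y (env (cv j))); last by right; left.
    by right; right; apply: mside xi yj.
  + by apply: FAll_sat => x; apply/sat_bigOr; have [i hi h] := mcol x; exists i.
  + apply: FAll_sat => t; apply: FAll_sat => t'; apply: FAll_sat => x;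
    apply: FAll_sat => y; apply/sat_bigAnd => j hj /=.
    have [xj|] := classic (@adj G x (env (cv j))); last by left.
    have [yj|] := classic (@adj G y (env (cv j))); last by right; left.
    have [xt|] := classic (@adj G x t); last by right; right; left.
    have [yt|] := classic (@adj G y t'); last by do 5!right.
    by have [h|h] := mchain j t t' x y hj xj yj xt yt; do 3!right; [left|right; left].
  + apply: FAll_sat => t; apply: FAll_sat => t'.
    have [ht|/notime h] := classic (time K P (@adj G) (fun i => env (cv i)) t);
      last by left; apply: h.
    have [ht'|/notime h] := classic (time K P (@adj G) (fun i => env (cv i)) t');
      last by right; left; apply: h.
    right; right; have [|[x x0 h]] := mext t t' ht ht'; first by left.
    by right; exists x.
  + apply: FAll_sat => x; apply/sat_bigAnd => j hj /=.
    have [xj|] := classic (@adj G x (env (cv j))); last by left.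
    by have [t tx tj] := mcov j x hj xj; right; exists t.
  + split=> /=; rewrite ?addn0 // => x.
    by have [/ms2|] := classic (@adj G x (env 0)); [right|left].
  + move=> t /=.
    have [tq|] := classic (@adj G t (env (cv (K.+1 + size P)))); last by left.
    right=> x; have [x0|] := classic (@adj G x (env (cv 0))); last by left.
    by right; apply: mhalt tq x0.
  + apply: FAll_sat => t; apply/sat_bigAnd => q hq /=.
    have [tq|] := classic (@adj G t (env (cv (K.+1 + q)))); last by left.
    have [a onP] := onth_size hq; right.
    have [t'] := mstep q a t onP tq; rewrite /Finstr onP.
    case: a {onP} => [x q'|x q1 q2].
      by case=> x0 [x1 [h1 h2 h3 h4 [h5 h6]]]; exists t', x0, x1.
    by case=> -[x0 [x1 [h1 h2 h3 h4 [h5 h6]]]]; [left|right]; exists t', x0, x1.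
Qed.

(** * Models of the sentence *)

Section Enumeration.

Variables (V : Type) (N : nat -> V -> Prop) (v : nat -> nat).

Hypothesis chainN : forall k k' x y, N k x -> N k' y -> N k' x \/ N k y.
(** This supplies, for each smaller size, an earlier set of exactly that size to compare with. *)
Hypothesis hitsv : forall k w, w <= v k -> exists2 k', k' <= k & v k' = w.

(** A single list has all the sets [N k] as initial segments, of lengths [v k]: in this sense each
    set depends only on its size. *)
Definition enumerates (xi : nat -> V) i := forall k, k <= i ->
  (forall x, N k x <-> exists2 l, l < v k & x = xi l) /\
  (forall l l', l < v k -> l' < v k -> xi l = xi l' -> l = l').

Inductive change i : Prop :=
| change_same of (forall x, N i.+1 x <-> N i x) & v i.+1 = v i
| change_incr z of ~ N i z & N i.+1 z & (forall x, x <> z -> (N i.+1 x <-> N i x))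
    & v i.+1 = (v i).+1
| change_decr z of N i z & ~ N i.+1 z & (forall x, x <> z -> (N i.+1 x <-> N i x))
    & v i = (v i.+1).+1.

Lemma enumerates_last xi i : enumerates xi i ->
  (forall x, N i.+1 x <-> exists2 l, l < v i.+1 & x = xi l) ->
  (forall l l', l < v i.+1 -> l' < v i.+1 -> xi l = xi l' -> l = l') ->
  enumerates xi i.+1.
Proof.
move=> en h1 h2 k; rewrite leq_eqVlt => /orP[/eqP -> //|]; exact: en.
Qed.

(* The chain condition forces the element added (or removed) at a size that was
   reached before to be the one already listed there. *)
Lemma enumerates_change i : (exists xi, enumerates xi i) -> change i ->
  exists xi, enumerates xi i.+1.
Proof.
case=> xi en; have [Ni injv] := en i (leqnn i).
case=> [NE vE|z Nz Nz' NE vE|z Nz Nz' NE vE].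
- exists xi; apply: enumerates_last => //; rewrite vE // => x.
  by rewrite NE.
(* Either size [v i + 1] has occurred before and [z] is already listed at position [v i], or the
   size is new and [z] is put there. *)
- have [[k ki vk]|seen] := classic (exists2 k, k <= i & v i < v k).
    have [k' k'k vk'] := hitsv vk; have k'i := leq_trans k'k ki.
    have [Nk' injk'] := en k' k'i; rewrite vk' in Nk' injk'.
    have Nxi : N k' (xi (v i)) by apply/Nk'; exists (v i).
    have Nk'z : N k' z.
      have [//|h] := chainN Nz' Nxi.
      have [<- //|/NE NEx] := classic (xi (v i) = z).
      have /Ni[l lv e] := NEx.1 h.
      by have := injk' _ _ (ltnSn _) (ltnW lv) e => e'; move: lv; rewrite e' ltnn.
    have zE : z = xi (v i).
      have /Nk'[l lv e] := Nk'z.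
      move: lv; rewrite ltnS leq_eqVlt => /orP[/eqP <- //|lv].
      by case: Nz; apply/Ni; exists l.
    exists xi; apply: enumerates_last => //; rewrite vE // => x.
    have [->|xz] := classic (x = z).
      by split=> // _; exists (v i).
    rewrite NE // Ni; split=> -[l lv xl]; exists l => //; first exact: ltnW.
    by move: lv; rewrite ltnS leq_eqVlt => /orP[/eqP lE|//]; case: xz; rewrite zE xl lE.
  have vle k : k <= i -> v k <= v i.
    by move=> ki; rewrite leqNgt; apply/negP => h; apply: seen; exists k.
  have xiE l : l < v i -> upd xi (v i) z l = xi l.
    by move=> lv; rewrite updE ltn_eqF.
  have xiz : upd xi (v i) z (v i) = z by rewrite updE eqxx.
  have nz l : l < v i -> xi l <> z by move=> lv e; apply/Nz/Ni; exists l.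
  exists (upd xi (v i) z); apply: enumerates_last => [k ki||].
  + have [Nk injk] := en k ki; have lvi l (lv : l < v k) := leq_trans lv (vle k ki).
    split=> [x|l l' lv lv']; last by rewrite !xiE ?lvi //; apply: injk.
    rewrite Nk; split=> -[l lv xl]; exists l => //; first by rewrite xiE ?lvi.
    by rewrite xl xiE ?lvi.
  + move=> x; have [->|xz] := classic (x = z).
      by split=> // _; exists (v i); rewrite ?vE ?xiz.
    rewrite NE // Ni vE; split=> -[l lv xl].
      by exists l; rewrite ?xiE // ltnW.
    move: lv; rewrite ltnS leq_eqVlt => /orP[/eqP lE|lv].
      by case: xz; rewrite xl lE xiz.
    by exists l; rewrite // -xiE.
  + move=> l l'; rewrite vE !ltnS (leq_eqVlt l) (leq_eqVlt l').
    case/orP=> [/eqP ->|lv]; case/orP=> [/eqP ->|lv'] //; rewrite ?xiz ?xiE //.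
    * by move=> e; case: (nz _ lv').
    * by move=> e; case: (nz _ lv).
    * exact: injv.
- have /Ni[l0 l0v zE] := Nz; rewrite vE in l0v.
  (* The removed element is the last one listed. Otherwise an earlier set of size [v i.+1] contains
     [z] but not [y], while [N i.+1] contains [y] but not [z]. *)
  have l0E : l0 = v i.+1.
    move: l0v; rewrite ltnS leq_eqVlt => /orP[/eqP //|l0v].
    have vi : v i.+1 <= v i by rewrite vE.
    have [k' k'i vk'] := hitsv vi.
    have [Nk' _] := en k' k'i; rewrite vk' in Nk'.
    have Nk'z : N k' z by apply/Nk'; exists l0.
    set y := xi (v i.+1); have Niy : N i y by apply/Ni; exists (v i.+1); rewrite ?vE.
    have yz : y <> z.
      rewrite zE => e; have := injv _ _ _ _ e; rewrite vE => /(_ (ltnSn _) (ltnW l0v)) e'.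
      by move: l0v; rewrite e' ltnn.
    have Ny : N i.+1 y by apply/(NE y yz).
    have [//|/Nk'[l lv e]] := chainN Nk'z Ny.
    have := injv _ _ _ _ e; rewrite vE => /(_ (ltnSn _) (ltnW lv)) e'.
    by move: lv; rewrite e' ltnn.
  exists xi; apply: enumerates_last => //.
    move=> x; have [->|xz] := classic (x = z).
      split=> // -[l lv xl]; have := injv l l0; rewrite vE -zE => /(_ _ _ (esym xl)).
      by rewrite l0E ltnSn ltnW // => /(_ isT isT) e; move: lv; rewrite e ltnn.
    rewrite NE // Ni vE; split=> -[l lv xl]; exists l => //; last exact: ltnW.
    move: lv; rewrite ltnS leq_eqVlt => /orP[/eqP lE|//].
    by case: xz; rewrite xl zE lE l0E.
  by move=> l l' lv lv'; apply: injv; rewrite vE ltnW.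
Qed.

End Enumeration.

(** * Register values along the run *)

Section Values.

Variable P : seq instr.

Definition state i := (conf P i).1.
Definition value i j := if j is x.+1 then (conf P i).2 x else i.

Lemma confS i : conf P i.+1 = step P (conf P i).
Proof. by []. Qed.

Lemma conf_inc i x q : onth P (state i) = Some (IInc x q) ->
  state i.+1 = q /\ forall j, value i.+1 j = value i j + (j == 0) + (j == x.+1).
Proof.
rewrite /state /value => onP; rewrite confS /step onP /=.
split=> // -[|j]; first by rewrite eqxx; lia.
by rewrite updE eqSS; case: eqP => [->|]; lia.
Qed.

Lemma conf_tst i x q1 q2 : onth P (state i) = Some (IDec x q1 q2) ->
  value i x.+1 = 0 ->
  state i.+1 = q2 /\ forall j, value i.+1 j = value i j + (j == 0).
Proof.
rewrite /state /value => onP vi; rewrite confS /step onP /= vi.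
by split=> // -[|j] /=; lia.
Qed.

Lemma conf_dec i x q1 q2 : onth P (state i) = Some (IDec x q1 q2) ->
  value i x.+1 != 0 ->
  state i.+1 = q1 /\ forall j, value i.+1 j = value i j + (j == 0) - (j == x.+1).
Proof.
rewrite /state /value => onP vi; rewrite confS /step onP /=.
rewrite (negbTE vi); split=> // -[|j] /=; first by lia.
by rewrite updE eqSS; case: eqP => [->|]; lia.
Qed.

Lemma value0 j : value 0 j = 0.
Proof. by case: j. Qed.

Lemma value_step i j : value i.+1 j <= (value i j).+1.
Proof.
case onP: (onth P (state i)) => [[x q|x q1 q2]|].
- by have [_ ->] := conf_inc onP; case: j => [|j] /=; lia.
- have [v0|v0] := eqVneq (value i x.+1) 0.
    by have [_ ->] := conf_tst onP v0; case: j => [|j] /=; lia.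
  by have [_ ->] := conf_dec onP v0; case: j => [|j] /=; lia.
- case: j => [|j] //; rewrite /value confS /step.
  by move: onP; rewrite /state => ->.
Qed.

Lemma value_le i j : value i j <= i.
Proof.
by elim: i => [|i IH]; [rewrite value0 | apply: leq_trans (value_step i j) _].
Qed.

Lemma value_hits j i w : w <= value i j -> exists2 k, k <= i & value k j = w.
Proof.
elim: i => [|i IH]; first by rewrite value0 leqn0 => /eqP ->; exists 0; rewrite ?value0.
have [wi _|wi wS] := leqP w (value i j).
  by have [k ki kw] := IH wi; exists k => //; apply: leqW.
by exists i.+1 => //; apply/eqP; rewrite eqn_leq wS (leq_trans (value_step i j)).
Qed.

End Values.

(** * The graph of a halting run *)

Section RunGraph.

Variables (K : nat) (P : seq instr) (T : nat).
Let nreg := K.+1.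
Let ncol := nreg + (size P).+1.

Local Notation element :=
  {p : 'I_nreg * 'I_T.+1 | [exists i : 'I_T.+1, p.2 < value P i p.1]}.

(* Colour vertices, times, and for each register one vertex per positive value
   it takes. *)
Definition rvert := ('I_ncol + ('I_T.+1 + element))%type.

(** Each edge is listed in one orientation and symmetrised in [radj]. A time at which a register has
    value [v] sees the elements of index below [v], so the neighbourhoods are initial segments. *)
Definition half (u v : rvert) : bool :=
  match u, v with
  | inl i, inr (inl t) => i == nreg + state P t :> nat
  | inl i, inr (inr p) => i == (sval p).1 :> nat
  | inr (inl t), inr (inr p) => (sval p).2 < value P t (sval p).1
  | _, _ => false
  end.

Definition radj : rel rvert := fun u v => half u v || half v u.

Lemma radj_simple : fin_simple radj.
Proof. by split=> [u v|[i|[t|p]]] //; rewrite /radj orbC. Qed.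

Hypothesis wfP : all (wf_instr K (size P)) P.
Hypothesis haltT : state P T = size P.
Hypothesis runT : forall i, i < T -> state P i < size P.

Lemma state_le i : i <= T -> state P i <= size P.
Proof. by rewrite leq_eqVlt => /orP[/eqP ->|/runT/ltnW //]; rewrite haltT. Qed.

Lemma nreg_state_lt i : i <= T -> nreg + state P i < ncol.
Proof. by move=> iT; rewrite /ncol ltn_add2l ltnS state_le. Qed.

Lemma nreg_lt j : j < nreg -> j < ncol.
Proof. by move=> jn; rewrite /ncol; lia. Qed.

(** * Every model is isomorphic to the graph of the run *)

Section Categoricity.

Variables (V : Type) (adj : V -> V -> Prop) (t0 : V) (c : nat -> V).
Hypothesis adj_sym : forall x y, adj x y -> adj y x.
Hypothesis M : model K P adj t0 c.

Lemma coloured_neq x i j : i < ncol -> j < ncol -> adj x (c i) -> x <> c j.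
Proof. by move=> hi hj xi xj; move: xi; rewrite xj; apply: (mod_cc M). Qed.

(** A successor is chosen for every vertex, arbitrarily where no instruction applies. By [mod_uniq]
    a vertex has at most one state, so one choice serves all [q] and [a]. *)
Lemma next_time : exists ts : nat -> V, ts 0 = t0 /\
  forall i q a, onth P q = Some a -> adj (ts i) (c (nreg + q)) ->
    instr_model K adj c q a (ts i) (ts i.+1).
Proof.
have [f hf] : exists f, forall t q a, onth P q = Some a -> adj t (c (nreg + q)) ->
    instr_model K adj c q a t (f t).
  apply: (functional_choice (fun t t' => forall q a, onth P q = Some a ->
    adj t (c (nreg + q)) -> instr_model K adj c q a t t')) => t.
  have [[q [a [onP tq]]]|none] := classic (exists q a,
    onth P q = Some a /\ adj t (c (nreg + q))); last first.
    by exists t => q a onP tq; case: none; exists q, a.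
  have [t' ht'] := mod_step M onP tq; exists t' => q' a' onP' tq'.
  have lt q1 a1 : onth P q1 = Some a1 -> nreg + q1 < ncol.
    move=> e; rewrite /ncol ltn_add2l ltnS leqNgt; apply/negP => h.
    by rewrite (onth_oversize (ltnW h)) in e.
  have /addnI qq := mod_uniq M (lt _ _ onP) (lt _ _ onP') tq tq'.
  by move: onP'; rewrite -qq onP => -[<-].
by exists (fun i => iter i f t0); split=> // i q a; apply: hf.
Qed.

Section Run.

Variable ts : nat -> V.
Hypothesis ts0 : ts 0 = t0.
Hypothesis tsS : forall i q a, onth P q = Some a -> adj (ts i) (c (nreg + q)) ->
  instr_model K adj c q a (ts i) (ts i.+1).

Definition elements j i x := adj x (c j) /\ adj x (ts i).

Notation listed j xi i := (enumerates (elements j) (fun k => value P k j) xi i).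

Lemma chain_elements j k k' x y : j < nreg ->
  elements j k x -> elements j k' y -> elements j k' x \/ elements j k y.
Proof.
move=> jn [xj xk] [yj yk'].
by have [h|h] := mod_chain M jn xj yj xk yk'; [left|right].
Qed.

Definition differ_at i x0 x := forall j y, j < nreg -> adj y (c j) ->
  y <> x0 -> y <> x -> elements j i.+1 y <-> elements j i y.

Lemma move_differ_at i q q' B : q <= size P -> q' <= size P ->
    move_model K adj c q q' B (ts i) (ts i.+1) ->
  adj (ts i.+1) (c (nreg + q')) /\
  exists x0 x, [/\ adj x0 (c 0), elements 0 i.+1 x0, ~ elements 0 i x0,
    B (ts i) (ts i.+1) x0 x & differ_at i x0 x].
Proof.
move=> qP q'P [x0 [x [tq' x00 x0i x0S [bx diff]]]]; split=> //.
exists x0, x; split=> //; first by case.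
have lt k : k <= size P -> nreg + k < ncol by rewrite /ncol ltn_add2l ltnS.
move=> j y jn yj y0 yx; have [//|[//|[h|[h|h]]]] := diff y.
- by case: (coloured_neq (nreg_lt jn) (lt _ qP) yj h).
- by case: (coloured_neq (nreg_lt jn) (lt _ q'P) yj h).
- by rewrite /elements; tauto.
Qed.

Lemma colour_neq x y j jx : j < nreg -> jx < nreg -> j <> jx ->
  adj x (c jx) -> adj y (c j) -> y <> x.
Proof.
move=> jn jxn jjx xj yj yx; apply: jjx; rewrite yx in yj.
exact: (mod_uniq M (nreg_lt jn) (nreg_lt jxn) yj xj).
Qed.

(** Here [x] is either the element that changes in register colour [jx] or the dummy [x0] of a zero
    test; in both cases [x0] is the only change of the clock. *)
Lemma change_clock i jx x0 x : jx < nreg -> adj x0 (c 0) ->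
    elements 0 i.+1 x0 -> ~ elements 0 i x0 -> differ_at i x0 x ->
    x = x0 \/ 0 <> jx /\ adj x (c jx) ->
  change (elements 0) (fun k => value P k 0) i.
Proof.
move=> jxn x00 x0S x0i diff hx; apply: (@change_incr _ _ _ _ x0) => // y yx0.
suff h : adj y (c 0) -> elements 0 i.+1 y <-> elements 0 i y.
  by split=> -[y0 yt]; apply/h.
move=> y0; apply: diff => //; case: hx => [-> //|[jx0 xj]].
exact: colour_neq jxn jx0 xj y0.
Qed.

Lemma change_other i j x0 x : j < nreg -> j <> 0 -> adj x0 (c 0) ->
    (forall y, adj y (c j) -> y <> x) -> differ_at i x0 x ->
    value P i.+1 j = value P i j ->
  change (elements j) (fun k => value P k j) i.
Proof.
move=> jn j0 x00 hx diff vE; apply: change_same => // y.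
suff h : adj y (c j) -> elements j i.+1 y <-> elements j i y.
  by split=> -[yj yt]; apply/h.
by move=> yj; apply: diff => //; [exact: (colour_neq _ _ j0 x00) | exact: hx].
Qed.

Lemma differ_at_same i j x0 x : j < nreg -> j <> 0 -> adj x0 (c 0) ->
    differ_at i x0 x ->
  forall y, y <> x -> elements j i.+1 y <-> elements j i y.
Proof.
move=> jn j0 x00 diff y yx.
suff h : adj y (c j) -> elements j i.+1 y <-> elements j i y.
  by split=> -[yj yt]; apply/h.
by move=> yj; apply: diff => //; exact: (colour_neq _ _ j0 x00).
Qed.

(** The enumerations up to [i] tell whether a register is empty, so the model takes the same branch
    of a decrement as the machine. *)
Lemma run_step i : i < T -> adj (ts i) (c (nreg + state P i)) ->
    (forall j, j < nreg -> exists xi, listed j xi i) ->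
  adj (ts i.+1) (c (nreg + state P i.+1)) /\
  forall j, j < nreg -> change (elements j) (fun k => value P k j) i.
Proof.
move=> iT sti en; have [a onP] := onth_size (runT iT).
have wfa := onth_all wfP onP; have qP := ltnW (runT iT).
have nonempty j y : j < nreg -> elements j i y -> value P i j != 0.
  by move=> jn yi; have [xi /(_ i (leqnn i))[/(_ y)/iffLR/(_ yi)[l lv _] _]] := en j jn;
    rewrite -lt0n; apply: leq_trans lv.
have inhab j : j < nreg -> value P i j != 0 -> exists y, elements j i y.
  move=> jn vj; have [xi /(_ i (leqnn i))[h _]] := en j jn.
  by exists (xi 0); apply/h; exists 0; rewrite // lt0n.
have := tsS onP sti; case: a onP wfa => [r q'|r q1 q2] onP /=.
- case/andP=> rK q'P /(move_differ_at qP q'P)[tq' [x0 [x [x00 x0S x0i [xr [xi xS]] diff]]]].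
  have [-> vE] := conf_inc onP; split=> // j jn.
  have [->|/eqP j0] := eqVneq j 0.
    by apply: (change_clock (jx := r.+1)) x00 x0S x0i diff _ => //; right.
  have [jr|/eqP jr] := eqVneq j r.+1.
    apply: (@change_incr _ _ _ _ x); rewrite ?jr //.
    + by case.
    + by apply: differ_at_same diff.
    + by rewrite vE eqxx addn0 addn1.
  apply: (change_other jn j0 x00 _ diff).
    by move=> y yj; apply: (colour_neq (jx := r.+1)) xr yj.
  by rewrite vE; lia.
- case/and3P=> rK q1P q2P [].
  + case/(move_differ_at qP q1P)=> tq' [x0 [x [x00 x0S x0i [xr [xi xS]] diff]]].
    have vr : value P i r.+1 != 0 by apply: (nonempty _ x).
    have [-> vE] := conf_dec onP vr; split=> // j jn.
    have [->|/eqP j0] := eqVneq j 0.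
      by apply: (change_clock (jx := r.+1)) x00 x0S x0i diff _ => //; right.
    have [jr|/eqP jr] := eqVneq j r.+1.
      apply: (@change_decr _ _ _ _ x); rewrite ?jr //.
      * by case.
      * by apply: differ_at_same diff.
      * by rewrite vE eqxx; move: vr; lia.
    apply: (change_other jn j0 x00 _ diff).
      by move=> y yj; apply: (colour_neq (jx := r.+1)) xr yj.
    by rewrite vE; lia.
  + case/(move_differ_at qP q2P)=> tq' [x0 [x [x00 x0S x0i [xE empty] diff]]].
    have vr : value P i r.+1 = 0.
      apply/eqP; apply: contraT => /inhab[//|y [yr yt]].
      by have [|] := empty y.
    have [-> vE] := conf_tst onP vr; split=> // j jn.
    have [->|/eqP j0] := eqVneq j 0.
      by apply: (change_clock (jx := 0)) x00 x0S x0i diff _ => //; left.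
    apply: (change_other jn j0 x00 _ diff).
      by move=> y yj; rewrite xE; apply: (colour_neq _ _ j0 x00).
    by rewrite vE; lia.
Qed.

(** States and enumerations need a joint induction: the enumerations decide the branch taken, and
    the move taken extends the enumerations. *)
Lemma run_states i : i <= T -> adj (ts i) (c (nreg + state P i)) /\
  forall j, j < nreg -> exists xi, listed j xi i.
Proof.
elim: i => [|i IH] iT.
  have [t0q h0] := mod_start M; rewrite ts0 addn0; split=> // j jn.
  exists (fun _ => t0) => k; rewrite leqn0 => /eqP ->; rewrite value0; split=> // x.
  split=> [[xj]|[//]]; rewrite ts0 => /h0 xE.
  have ltc : nreg < ncol by rewrite /ncol; lia.
  by case: (coloured_neq (nreg_lt jn) ltc xj xE).
have [sti en] := IH (ltnW iT); have [stS ch] := run_step iT sti en.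
split=> // j jn; apply: enumerates_change (en j jn) (ch j jn).
- by move=> k k' x y; apply: chain_elements.
- by move=> k w; apply: value_hits.
Qed.

Lemma run_enumeration : exists xi : nat -> nat -> V,
  forall j, j < nreg -> listed j (xi j) T.
Proof.
apply: (functional_choice (fun j xi => j < nreg -> listed j xi T)) => j.
have [_ h] := run_states (leqnn T).
by have [/h[xi hxi]|jn] := boolP (j < nreg); [exists xi | exists (fun _ => t0)].
Qed.

Section Isomorphism.

Variable xi : nat -> nat -> V.
Hypothesis hxi : forall j, j < nreg -> listed j (xi j) T.

Lemma time_run i : i <= T -> adj (ts i) (c (nreg + state P i)).
Proof. by move=> iT; have [] := run_states iT. Qed.

Lemma elements_xi j i x : j < nreg -> i <= T ->
  elements j i x <-> exists2 l, l < value P i j & x = xi j l.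
Proof. by move=> jn iT; have [] := hxi jn iT. Qed.

Lemma xi_colour j i l : j < nreg -> i <= T -> l < value P i j ->
  adj (xi j l) (c j) /\ adj (xi j l) (ts i).
Proof. by move=> jn iT lv; apply/(elements_xi _ jn iT); exists l. Qed.

Lemma xi_inj j i i' l l' : j < nreg -> i <= T -> i' <= T ->
  l < value P i j -> l' < value P i' j -> xi j l = xi j l' -> l = l'.
Proof.
move=> jn iT i'T lv lv' e; have [vv|/ltnW vv] := leqP (value P i j) (value P i' j).
  by have [_] := hxi jn i'T; apply=> //; apply: leq_trans vv.
by have [_] := hxi jn iT; apply=> //; apply: leq_trans vv.
Qed.

Lemma adj_xi j i i' l : j < nreg -> i <= T -> i' <= T -> l < value P i j ->
  adj (ts i') (xi j l) <-> l < value P i' j.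
Proof.
move=> jn iT i'T lv; have [xj _] := xi_colour jn iT lv.
split=> [/adj_sym h|lv']; last by apply/adj_sym; case: (xi_colour jn i'T lv').
have /(elements_xi _ jn i'T)[l' lv' e] : elements j i' (xi j l) by [].
by rewrite (xi_inj jn iT i'T lv lv' e).
Qed.

(* The chain condition makes the clock set of [t] one of the clock sets of the
   run, and extensionality then identifies [t]. *)
Lemma time_in_run t : time K P adj c t -> exists2 i, i <= T & t = ts i.
Proof.
move=> ht; pose A l := adj (xi 0 l) t.
have ex n : n <= T -> (forall l, l < n -> A l) \/
    exists2 i, i < n & (forall l, l < i -> A l) /\ ~ A i.
  elim: n => [|n IH] nT; first by left.
  have [all|[i ilt hi]] := IH (ltnW nT); last by right; exists i => //; apply: leqW.
  have [An|An] := classic (A n); last by right; exists n.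
  by left=> l; rewrite ltnS leq_eqVlt => /orP[/eqP ->|/all].
(* [i] is the first index whose clock element is missing from [t], or [T] if none below [T] is
   missing. *)
have [i iT [below above]] : exists2 i, i <= T &
    (forall l, l < i -> A l) /\ (i < T -> ~ A i).
  have [all|[i ilt [h1 h2]]] := ex T (leqnn T).
    by exists T => //; split=> //; rewrite ltnn.
  by exists i; [apply: ltnW | split].
exists i => //.
have hti : time K P adj c (ts i) by exists (state P i); [apply: state_le | apply: time_run].
have [//|[x x0 hx]] := mod_ext M ht hti.
(* The halting time sees every clock element, so the element separating [t] from [ts i] is one of
   those listed. *)
have xT : elements 0 T x.
  split=> //; apply: (mod_halt M _ x0).
  by have := time_run (leqnn T); rewrite haltT.
have /(elements_xi _ _ (leqnn T))[//|l lT xE] := xT.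
rewrite /= in lT.
have xi_time k : k <= T -> adj x (ts k) <-> l < k.
  move=> kT; have h := @adj_xi 0 T k l isT (leqnn T) kT lT.
  by split=> [/adj_sym|/h/adj_sym]; rewrite xE // => /h.
case: hx => -[h1 h2]; last first.
  by case: h1; rewrite xE; apply: below; apply/xi_time.
have il : i < l.
  have iT' : i < T.
    rewrite ltn_neqAle iT andbT; apply/eqP => iE; apply/h2/xi_time => //.
    by rewrite iE.
  rewrite ltn_neqAle; apply/andP; split; last first.
    by rewrite leqNgt; apply/negP => h; apply/h2/xi_time.
  by apply/eqP => iE; apply: (above iT'); rewrite iE /A -xE.
have iT' : i < T by apply: ltn_trans lT.
have [yc yt] := @xi_colour 0 i.+1 i isT iT' (ltnSn i).
(* Now [t] contains the clock element of index [l] but not that of index [i], while [ts i.+1]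
   contains the latter but not the former: a crossing pair. *)
have [h|h] := mod_chain M (j := 0) isT x0 yc h1 yt.
  by move/(xi_time _ iT'): h; rewrite ltnS leqNgt il.
by case: (above iT').
Qed.

(** The vertex [t] given by coverage is not a colour vertex, and [mod_side] excludes register
    colours for it; hence it is a time, and so a time of the run. *)
Lemma element_in_run j x : j < nreg -> adj x (c j) ->
  exists i l, [/\ i <= T, l < value P i j & x = xi j l].
Proof.
move=> jn xj; have [t tx tj] := mod_cov M jn xj.
have jc := nreg_lt jn; have [k kc [tE|tk]] := mod_col M t.
  by case: tj; rewrite tE; congr c; apply: (mod_uniq M kc jc _ xj); rewrite -tE; apply: adj_sym.
have [kn|kn] := ltnP k nreg.
  by case: (mod_side M kc jc _ tk xj tx); rewrite -/nreg kn jn.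
have [|i iT tE] := @time_in_run t.
  exists (k - nreg); last by rewrite subnKC.
  by move: kc kn; rewrite /ncol; lia.
have /(elements_xi _ jn iT)[l lv xE] : elements j i x.
  by split=> //; rewrite -tE; apply: adj_sym.
by exists i, l.
Qed.

Definition embed (u : rvert) : V :=
  match u with
  | inl i => c i
  | inr (inl t) => ts t
  | inr (inr p) => xi (sval p).1 (sval p).2
  end.

Lemma rvert_ex (p : element) :
  exists2 i, i <= T & (sval p).2 < value P i (sval p).1.
Proof. by case: p => p /= /existsP[i hi]; exists i; rewrite // -ltnS. Qed.

Lemma embed_half u v : half u v -> adj (embed u) (embed v).
Proof.
case: u v => [i|[t|p]] [i'|[t'|p']] //=.
- by move/eqP => ->; apply/adj_sym/time_run; rewrite -ltnS.
- move/eqP => ->; have [k kT lv] := rvert_ex p'.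
  by have [/adj_sym] := xi_colour (ltn_ord _) kT lv.
- move=> lv; have tT : t <= T by rewrite -ltnS.
  by have [_ /adj_sym] := xi_colour (ltn_ord _) tT lv.
Qed.

Lemma half_embed u v : adj (embed u) (embed v) -> radj u v.
Proof.
have ord (t : 'I_T.+1) : t <= T by rewrite -ltnS.
have const_time i (t : 'I_T.+1) : adj (ts t) (c i) -> i < ncol -> i = nreg + state P t.
  by move=> h ic; apply: (mod_uniq M ic (nreg_state_lt (ord t)) h); apply: time_run.
have const_elt i p : adj (embed (inr (inr p))) (c i) -> i < ncol -> i = (sval p).1.
  move=> h ic; have [k kT lv] := rvert_ex p.
  by apply: (mod_uniq M ic (nreg_lt (ltn_ord _)) h); case: (xi_colour (ltn_ord _) kT lv).
have time_elt (t : 'I_T.+1) p : adj (ts t) (embed (inr (inr p))) ->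
    (sval p).2 < value P t (sval p).1.
  by have [k kT lv] := rvert_ex p => /(adj_xi (ltn_ord _) kT (ord t) lv).
rewrite /radj; case: u v => [i|[t|p]] [i'|[t'|p']] h /=.
- by case: (mod_cc M (ltn_ord i) (ltn_ord i') h).
- by rewrite orbF; apply/eqP/const_time => //; apply: adj_sym.
- by rewrite orbF; apply/eqP/const_elt => //; apply: adj_sym.
- by apply/eqP/const_time.
- case: (mod_side M (nreg_state_lt (ord t)) (nreg_state_lt (ord t')) _
    (time_run (ord t)) (time_run (ord t')) h); rewrite -/nreg; lia.
- by rewrite orbF; apply: time_elt.
- by apply/eqP/const_elt.
- by apply/time_elt/adj_sym.
- have [k kT lv] := rvert_ex p; have [k' kT' lv'] := rvert_ex p'.
  have [xj _] := xi_colour (ltn_ord _) kT lv; have [xj' _] := xi_colour (ltn_ord _) kT' lv'.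
  case: (mod_side M (nreg_lt (ltn_ord _)) (nreg_lt (ltn_ord _)) _ xj xj' h).
  by rewrite -/nreg !ltn_ord.
Qed.

Lemma embed_adj u v : radj u v <-> adj (embed u) (embed v).
Proof.
split; last exact: half_embed.
by case/orP=> /embed_half // /adj_sym.
Qed.

(** Vertices of different kinds are told apart by colours, two times by a clock element, and two
    elements of one colour by [xi_inj]. *)
Lemma embed_inj : injective embed.
Proof.
have ord (t : 'I_T.+1) : t <= T by rewrite -ltnS.
have colt (t : 'I_T.+1) := time_run (ord t).
have colx p : adj (embed (inr (inr p))) (c (sval p).1).
  by have [k kT lv] := rvert_ex p; have [] := xi_colour (ltn_ord _) kT lv.
have lt t := nreg_state_lt (ord t).
have ct (i : 'I_ncol) (t : 'I_T.+1) : c i <> ts t.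
  by move=> e; exact: (coloured_neq (lt t) (ltn_ord i) (colt t) (esym e)).
have cx (i : 'I_ncol) p : c i <> embed (inr (inr p)).
  by move=> e; exact: (coloured_neq (nreg_lt (ltn_ord _)) (ltn_ord i) (colx p) (esym e)).
have tx (t : 'I_T.+1) p : ts t <> embed (inr (inr p)).
  move=> e; have h := colx p; rewrite -e in h.
  have := mod_uniq M (lt t) (nreg_lt (ltn_ord _)) (colt t) h.
  by have := ltn_ord (sval p).1; lia.
case=> [i|[t|p]] [i'|[t'|p']].
- move=> e; congr inl; apply: val_inj; apply/eqP; apply: contraT => ii.
  by case: (mod_neq M (ltn_ord i) (ltn_ord i') ii).
- by move/ct.
- by move/cx.
- by move/esym/ct.
- move=> /= e; congr (inr (inl _)); apply: val_inj => /=; apply/eqP; apply: contraT.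
  have clock (k k' : 'I_T.+1) : k < k' -> ts k <> ts k'.
    move=> kk' e'; have [_ h] := @xi_colour 0 k' k isT (ord k') kk'.
    rewrite -e' in h; have := (@adj_xi 0 k' k k isT (ord k') (ord k) kk').1.
    by rewrite /= ltnn; move/(_ (adj_sym h)).
  by rewrite neq_ltn => /orP[/clock|/clock/nesym].
- by move/tx.
- by move/esym/cx.
- by move/esym/tx.
- move=> e; congr (inr (inr _)); apply: val_inj.
  have h := colx p'; rewrite -e in h.
  have j1 := mod_uniq M (nreg_lt (ltn_ord _)) (nreg_lt (ltn_ord _)) (colx p) h.
  have [k kT lv] := rvert_ex p; have [k' kT' lv'] := rvert_ex p'.
  move: e lv lv' j1 => /=; case: (sval p) (sval p') => [j l] [j' l'] /= e lv lv' j1.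
  move: e lv'; rewrite -j1 => e lv'.
  have l1 := xi_inj (ltn_ord j) kT kT' lv lv' e.
  by congr pair; apply: val_inj.
Qed.

Lemma embed_surj x : exists u, embed u = x.
Proof.
have [k kc [->|xk]] := mod_col M x; first by exists (inl (Ordinal kc)).
have [kn|kn] := ltnP k nreg.
  have [i [l [iT lv ->]]] := element_in_run kn xk.
  have lT : l < T.+1 by rewrite ltnS (leq_trans (ltnW lv)) // (leq_trans (value_le _ _ _)).
  have h : [exists i : 'I_T.+1, l < value P i k].
    by apply/existsP; exists (Ordinal (iT : i < T.+1)).
  by exists (inr (inr (exist _ (Ordinal kn, Ordinal lT) h))).
have [|i iT ->] := @time_in_run x.
  exists (k - nreg); last by rewrite subnKC.
  by move: kc kn; rewrite /ncol; lia.
by exists (inr (inl (Ordinal (iT : i < T.+1)))).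
Qed.

End Isomorphism.

End Run.

(** The isomorphism is a right inverse of [embed] obtained by choice; injectivity makes it
    two-sided. *)
Lemma model_iso : graph_iso (@Graph V adj) (fin_graph radj).
Proof.
have [ts [ts0 tsS]] := next_time; have [xi hxi] := run_enumeration ts0 tsS.
have [g gK] := functional_choice _ (embed_surj ts0 tsS hxi).
have inj := embed_inj ts0 tsS hxi.
exists g; split; first by exists (embed ts xi) => // u; apply: inj; rewrite gK.
move=> x y; rewrite -{1}(gK x) -{1}(gK y); apply: iff_sym; exact: embed_adj.
Qed.

End Categoricity.



(** * The graph of a run is a model *)

Section RunModel.

(** [inord] makes this total, with the first colour out of range, since an environment interprets
    all variables. *)
Definition colour_vertex i : rvert := inl (inord i : 'I_ncol).
Definition time_vertex k : rvert := inr (inl (inord k)).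

Let radjP : rvert -> rvert -> Prop := fun u v => radj u v.

Lemma radj_colour u i : i < ncol -> radj u (colour_vertex i) =
  match u with
  | inl _ => false
  | inr (inl t) => i == nreg + state P t
  | inr (inr p) => i == (sval p).1
  end.
Proof. by move=> ic; case: u => [j|[t|p]]; rewrite /radj /= ?inordK. Qed.

Lemma radj_time u k : k <= T -> radj u (time_vertex k) =
  match u with
  | inl i => i == nreg + state P k :> nat
  | inr (inl _) => false
  | inr (inr p) => (sval p).2 < value P k (sval p).1
  end.
Proof.
by move=> kT; case: u => [j|[t|p]]; rewrite /radj /= ?inordK ?orbF.
Qed.

Lemma element_ex j i l : j < nreg -> i <= T -> l < value P i j ->
  exists p : element,
    (sval p).1 = j :> nat /\ (sval p).2 = l :> nat.
Proof.
move=> jn iT lv.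
have lT : l < T.+1 by rewrite ltnS (leq_trans (ltnW lv)) // (leq_trans (value_le _ _ _)).
have h : [exists i : 'I_T.+1, l < value P i j].
  by apply/existsP; exists (Ordinal (iT : i < T.+1)).
by exists (exist _ (Ordinal jn, Ordinal lT) h).
Qed.

Lemma radj_time_ord u (t : 'I_T.+1) : radj u (inr (inl t)) =
  match u with
  | inl i => i == nreg + state P t :> nat
  | inr (inl _) => false
  | inr (inr p) => (sval p).2 < value P t (sval p).1
  end.
Proof. by case: u => [j|[t'|p]]; rewrite /radj /= ?orbF. Qed.

(** The clock always gains its element of index [i] here; what distinguishes the instructions is
    left to [x] and [B]. *)
Lemma move_run i q' B j (x0 x : element) : i < T -> q' = state P i.+1 ->
    (sval x0).1 = 0 :> nat -> (sval x0).2 = i :> nat ->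
    (forall p, p <> x0 -> p <> x -> ((sval p).2 < value P i (sval p).1) =
       ((sval p).2 < value P i.+1 (sval p).1)) ->
    B (time_vertex i) (time_vertex i.+1) (inr (inr x0)) (inr (inr x)) -> j = state P i ->
  move_model K radjP colour_vertex j q' B (time_vertex i) (time_vertex i.+1).
Proof.
move=> iT -> x01 x02 same bx ->; have iT' := ltnW iT.
exists (inr (inr x0)), (inr (inr x)); rewrite /radjP; split.
- by rewrite radj_colour ?nreg_state_lt //= inordK ?eqxx.
- by rewrite radj_colour //= x01.
- by rewrite radj_time //= x01 x02 /= ltnn.
- by rewrite radj_time //= x01 x02 /=.
- split=> // y; case: y => [k|[t|p]].
  + have [ki|ki] := eqVneq (k : nat) (nreg + state P i).
      do 2 right; left; congr inl; apply: val_inj.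
      by rewrite /= inordK // nreg_state_lt.
    have [kS|kS] := eqVneq (k : nat) (nreg + state P i.+1).
      do 3 right; left; congr inl; apply: val_inj.
      by rewrite /= inordK // nreg_state_lt.
    by do 4 right; right; rewrite !radj_time // (negbTE ki) (negbTE kS).
  + by do 4 right; right; rewrite !radj_time.
  + have [->|p0] := eqVneq p x0; first by left.
    have [->|px] := eqVneq p x; first by right; left.
    do 4 right; rewrite !radj_time // (same _ (elimN eqP p0) (elimN eqP px)).
    by case: (_ < _); [left | right].
Qed.

Lemma run_model : model K P radjP (time_vertex 0) colour_vertex.
Proof.
have nS q : q <= size P -> nreg + q < ncol by rewrite /ncol ltn_add2l ltnS.
have n0 : 0 < ncol by [].
split; rewrite /radjP -/nreg -/ncol.
- move=> i j ic jc /eqP ij [/(congr1 val)]; rewrite /= !inordK //.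
- by move=> i j ic jc; rewrite radj_colour.
- move=> i j x ic jc; rewrite !radj_colour //; case: x => // -[t|p].
    by move=> /eqP -> /eqP ->.
  by move=> /eqP -> /eqP ->.
- move=> i j x y ic jc ij; rewrite !radj_colour //.
  case: x y => // -[t|p] [//|[t'|p']] /eqP iE /eqP jE; rewrite /radj //=.
    by have := ltn_ord (sval p').1; lia.
  by have := ltn_ord (sval p).1; lia.
- case=> [i|[t|p]].
  + by exists i; [|left; congr inl; apply: val_inj; rewrite /= inordK].
  + by exists (nreg + state P t); [|right; rewrite radj_colour //]; rewrite nreg_state_lt // -ltnS.
  + by exists (sval p).1; [|right; rewrite radj_colour //]; rewrite nreg_lt.
- move=> j t t' x y jn; have jc := nreg_lt jn; rewrite !radj_colour //.
  case: x y => [//|[t1|p]] [//|[t2|p']].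
  + by move=> /eqP jE; move: jn; rewrite jE; lia.
  + by move=> /eqP jE; move: jn; rewrite jE; lia.
  + by move=> _ /eqP jE; move: jn; rewrite jE; lia.
  move=> /eqP jp /eqP jp'.
  have const i q : radj (inr (inr q)) (inl i) = (i == (sval q).1 :> nat) by [].
  have elt q q' : radj (inr (inr q)) (inr (inr q')) = false by [].
  (* The chain condition ranges over all vertices: a colour vertex sees all elements of colour [j]
     or none, an element sees none, and a time sees an initial segment. *)
  case: t t' => [i|[t|q]] [i'|[t'|q']]; rewrite ?radj_time_ord ?const ?elt //.
  + by move=> /eqP -> /eqP ->; left; rewrite -jp -jp'.
  + by move=> /eqP -> _; right; rewrite -jp jp'.
  + by move=> _ /eqP ->; left; rewrite -jp' jp.
  + rewrite -jp -jp' => h h'.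
    have [vv|/ltnW vv] := leqP (value P t j) (value P t' j).
      by left; apply: leq_trans vv.
    by right; apply: leq_trans vv.
- have isT' t : time K P radjP colour_vertex t -> exists k : 'I_T.+1, t = inr (inl k).
    case=> q qP; rewrite /radjP radj_colour ?nS //; case: t => // -[t|p] /eqP.
      by exists t.
    by have := ltn_ord (sval p).1; lia.
  move=> t t' /isT'[k ->] /isT'[k' ->].
  have clock (k1 k2 : 'I_T.+1) : k1 < k2 -> exists x, [/\ radj x (colour_vertex 0),
      radj x (inr (inl k2)) & ~ radj x (inr (inl k1))].
    move=> kk; have kT : k2 <= T by rewrite -ltnS.
    have [p [p1 p2]] := @element_ex 0 k2 k1 isT kT kk.
    exists (inr (inr p)); rewrite radj_colour // !radj_time_ord p1 p2 /=.
    by split=> //; rewrite ltnn.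
  have [kk|kk|kk] := ltngtP k k'.
  + by right; have [x [x0 h1 h2]] := clock _ _ kk; exists x => //; right.
  + by right; have [x [x0 h1 h2]] := clock _ _ kk; exists x => //; left.
  + by left; congr (inr (inl _)); apply: val_inj.
- move=> j x jn; rewrite radj_colour ?nreg_lt //; case: x => // -[t|p] /eqP jE.
    by move: jn; rewrite jE; lia.
  have [k] := existsP (valP p) => hk.
  by exists (inr (inl k)) => //; rewrite /radj /= hk.
- split; first by rewrite -[nreg in colour_vertex nreg]addn0 radj_colour ?nS //= inordK.
  case=> [i|[t|p]]; rewrite radj_time // ?value0 //= => /eqP iE.
  have iN : i = nreg :> nat by rewrite iE addn0.
  by congr inl; apply: val_inj; rewrite /= inordK -?iN.
- move=> t x; rewrite !radj_colour ?nS //; case: t => // -[t|p] /eqP tE; last first.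
    by have := ltn_ord (sval p).1; lia.
  case: x => // -[t'|p] /eqP pE; first by lia.
  rewrite radj_time_ord -pE /=.
  (* Only the last time is halting, and every clock element has index below [T]. *)
  have tT : t = T :> nat.
    apply/eqP; rewrite eqn_leq -ltnS ltn_ord /= leqNgt; apply/negP => /runT.
    by lia.
  have [k] := existsP (valP p); rewrite -pE /= tT => /leq_trans; apply.
  by rewrite -ltnS.
- move=> q a t onP; have qP : q < size P.
    by rewrite ltnNge; apply/negP => /onth_oversize; rewrite onP.
  rewrite radj_colour ?nS ?(ltnW qP) //; case: t => // -[t|p] /eqP tE; last first.
    by have := ltn_ord (sval p).1; lia.
  have {tE} qE : q = state P t by lia.
  have tT : t < T.
    rewrite ltn_neqAle -ltnS ltn_ord andbT; apply/eqP => tE.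
    by move: qP; rewrite qE tE haltT ltnn.
  have tT' := ltnW tT.
  have -> : inr (inl t) = time_vertex t.
    by congr (inr (inl _)); apply: val_inj; rewrite /= inordK.
  exists (time_vertex t.+1).
  have [x0 [x01 x02]] := @element_ex 0 t.+1 t isT tT (ltnSn t).
  have wfa := onth_all wfP onP; rewrite qE in onP.
  have neq (p p' : element) : p <> p' -> (sval p).1 = (sval p').1 :> nat ->
      (sval p).2 = (sval p').2 :> nat ->
      False.
    move=> pp e1 e2; apply: pp; apply: val_inj => /=.
    case: (sval p) (sval p') e1 e2 => [a1 b1] [a2 b2] /= e1 e2.
    by congr pair; apply: val_inj.
  case: a onP wfa => [r q'|r q1 q2] onP /=.
  + case/andP=> rK _; have [sE vE] := conf_inc onP.
    (* The first index absent at time [t] is the one an increment adds. *)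
    have [x [x1 x2]] : exists p : element,
      (sval p).1 = r.+1 :> nat /\ (sval p).2 = value P t r.+1 :> nat.
      by apply: (@element_ex _ t.+1) => //; rewrite vE eqxx; lia.
    apply: (move_run tT (esym sE) x01 x02 (x := x)) => //.
      move=> p px0 px; have := neq _ _ px0; have := neq _ _ px.
      rewrite x01 x02 x1 x2 vE; move: (nat_of_ord _) (nat_of_ord _) => l j.
      have [->|jr] := eqVneq j r.+1; first by rewrite /=; lia.
        by have [->|j0] := eqVneq j 0; rewrite /=; lia.
    rewrite /inc_model /radjP radj_colour ?nreg_lt // !radj_time // x1 x2 eqxx ltnn vE eqxx.
    by split=> //; split=> //; lia.
  + case/and3P=> rK _ _; have [vr|vr] := eqVneq (value P t r.+1) 0.
    * right; have [sE vE] := conf_tst onP vr.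
      apply: (move_run tT (esym sE) x01 x02 (x := x0)) => //.
        move=> p px0 _; have := neq _ _ px0; rewrite x01 x02 vE.
        move: (nat_of_ord _) (nat_of_ord _) => l j.
        by have [->|j0] := eqVneq j 0; rewrite /=; lia.
      split=> // y; rewrite /radjP radj_colour ?nreg_lt // radj_time //.
      case: y => [i|[k|p]]; [by left | by right |].
      by have [<-|_] := eqVneq r.+1 _; [right; rewrite vr | left].
    * left; have [sE vE] := conf_dec onP vr.
      (* The value after the decrement is the last index present at time [t], which is the one
         removed. *)
      have [x [x1 x2]] : exists p : element,
        (sval p).1 = r.+1 :> nat /\ (sval p).2 = value P t.+1 r.+1 :> nat.
        by apply: (@element_ex _ t) => //; rewrite vE eqxx; lia.
      apply: (move_run tT (esym sE) x01 x02 (x := x)) => //.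
        move=> p px0 px; have := neq _ _ px0; have := neq _ _ px.
        rewrite x01 x02 x1 x2 !vE; move: (nat_of_ord _) (nat_of_ord _) => l j.
        have [->|jr] := eqVneq j r.+1; first by rewrite /=; lia.
        by have [->|j0] := eqVneq j 0; rewrite /=; lia.
      rewrite /dec_model /radjP radj_colour ?nreg_lt // !radj_time // x1 x2 eqxx ltnn.
      by split=> //; split=> //; rewrite vE eqxx; lia.
Qed.

End RunModel.

End RunGraph.

(** * Length and alternation number *)

Section Syntax.

(* Alternations of [A] when it follows a quantifier of kind [b]. *)
Fixpoint qalt b A : nat :=
  match A with
  | FAdj _ _ | FEq _ _ => 0
  | FNeg B => qalt b B
  | FAnd B C | FOr B C => maxn (qalt b B) (qalt b C)
  | FEx _ B => ~~ b + qalt true B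
  | FAll _ B => b + qalt false B
  end.

(** [qalt] passes through negations unchanged; this is right because in negation normal form they
    stand only before atoms. *)
Lemma nest_qalt b A w : nnf A -> w \in nest A -> word_alt (b :: w) <= qalt b A.
Proof.
elim: A b w => [x y|x y|A _|A IHA B IHB|A IHA B IHB|x A IH|x A IH] b w.
- by rewrite /= inE => _ /eqP ->.
- by rewrite /= inE => _ /eqP ->.
- by case: A => //= x y _; rewrite inE => /eqP ->.
- case/andP=> hA hB; rewrite /= mem_cat leq_max.
  by case/orP=> [/(IHA b _ hA) -> //|/(IHB b _ hB) ->]; rewrite orbT.
- case/andP=> hA hB; rewrite /= mem_cat leq_max.
  by case/orP=> [/(IHA b _ hA) -> //|/(IHB b _ hB) ->]; rewrite orbT.
- move=> hA /mapP[u uA ->]; have := IH true u hA uA.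
  by case: b => /=; lia.
- move=> hA /mapP[u uA ->]; have := IH false u hA uA.
  by case: b => /=; lia.
Qed.

Lemma alt_qalt A : nnf A -> alt A <= qalt true A.
Proof.
move=> hA; apply/bigmax_leqP_seq => w wA _; apply: leq_trans (nest_qalt true hA wA).
by case: w {wA} => //= a w; apply: leq_addl.
Qed.

(** The allowed variables are carried inwards instead of filtering lists outwards, so that
    closedness is checked by computation. *)
Fixpoint closed_in (p : pred nat) A : bool :=
  match A with
  | FAdj x y | FEq x y => p x && p y
  | FNeg B => closed_in p B
  | FAnd B C | FOr B C => closed_in p B && closed_in p C
  | FEx x B | FAll x B => closed_in (fun y => (y == x) || p y) B
  end.

Lemma all_fv p A : all p (fv A) = closed_in p A.
Proof.
elim: A p => [x y|x y|A IH|A IHA B IHB|A IHA B IHB|x A IH|x A IH] p //=;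
  rewrite ?andbT ?all_cat ?IHA ?IHB //; rewrite -IH all_filter;
  by apply: eq_all => y /=; rewrite implybE negbK.
Qed.

Lemma closed_in_sub (p p' : pred nat) A :
  subpred p p' -> closed_in p A -> closed_in p' A.
Proof. by move=> h; rewrite -!all_fv; apply: sub_all. Qed.

(** The interval from 10 to [n + 10] consists of the indices [cv i] with [i < n]. *)
Lemma closed_exs (p : pred nat) n B :
  closed_in (fun y => (10 <= y < n.+4.+4.+2) || p y) B -> closed_in p (exs n B).
Proof.
elim: n p => [|n IH] p /= h.
  by apply: closed_in_sub h => y /orP[|//]; lia.
by apply: IH; apply: closed_in_sub h => y /orP[h|->]; rewrite ?orbT //; lia.
Qed.

Section Big.

Variables (n : nat) (F : nat -> form).

Lemma nnf_bigAnd : (forall i, nnf (F i)) -> nnf (bigAnd n F).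
Proof. by move=> h; rewrite bigAnd.unlock; elim: (iota 0 n) => //= i l ->; rewrite h. Qed.

Lemma nnf_bigOr : (forall i, nnf (F i)) -> nnf (bigOr n F).
Proof. by move=> h; rewrite bigOr.unlock; elim: (iota 0 n) => //= i l ->; rewrite h. Qed.

Lemma qalt_bigAnd b k : (forall i, qalt b (F i) <= k) -> qalt b (bigAnd n F) <= k.
Proof.
by move=> h; rewrite bigAnd.unlock; elim: (iota 0 n) => //= i l IH; rewrite geq_max h.
Qed.

Lemma qalt_bigOr b k : (forall i, qalt b (F i) <= k) -> qalt b (bigOr n F) <= k.
Proof.
by move=> h; rewrite bigOr.unlock; elim: (iota 0 n) => //= i l IH; rewrite geq_max h.
Qed.

Lemma closed_bigAnd (p : pred nat) : p 0 ->
  (forall i, i < n -> closed_in p (F i)) -> closed_in p (bigAnd n F).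
Proof.
move=> p0 h; have {h} : forall i, i \in iota 0 n -> closed_in p (F i).
  by move=> i; rewrite mem_iota; apply: h.
rewrite bigAnd.unlock; elim: (iota 0 n) => [|i l IH] h /=; first by rewrite p0.
rewrite h ?mem_head // IH // => j jl; apply: h; by rewrite inE jl orbT.
Qed.

Lemma closed_bigOr (p : pred nat) : p 0 ->
  (forall i, i < n -> closed_in p (F i)) -> closed_in p (bigOr n F).
Proof.
move=> p0 h; have {h} : forall i, i \in iota 0 n -> closed_in p (F i).
  by move=> i; rewrite mem_iota; apply: h.
rewrite bigOr.unlock; elim: (iota 0 n) => [|i l IH] h /=; first by rewrite p0.
rewrite h ?mem_head // IH // => j jl; apply: h; by rewrite inE jl orbT.
Qed.

Lemma flen_bigAnd k : (forall i, flen (F i) <= k) ->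
  flen (bigAnd n F) <= n * (k + 3) + 3.
Proof.
move=> h; rewrite bigAnd.unlock -{2}(size_iota 0 n); elim: (iota 0 n) => //= i l IH.
by have := h i; rewrite mulSn; lia.
Qed.

Lemma flen_bigOr k : (forall i, flen (F i) <= k) ->
  flen (bigOr n F) <= n * (k + 3) + 4.
Proof.
move=> h; rewrite bigOr.unlock -{2}(size_iota 0 n); elim: (iota 0 n) => //= i l IH.
by have := h i; rewrite mulSn; lia.
Qed.

End Big.

Lemma sat_fv G (env env' : nat -> vert G) A :
  (forall y, y \in fv A -> env y = env' y) -> sat env A <-> sat env' A.
Proof.
elim: A env env' => [x y|x y|A IH|A IHA B IHB|A IHA B IHB|x A IH|x A IH] env env' h /=.
- by rewrite !h // !inE eqxx ?orbT.
- by rewrite !h // !inE eqxx ?orbT.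
- by rewrite (IH env env').
- by rewrite (IHA env env') ?(IHB env env') // => y yA; apply: h; rewrite mem_cat yA ?orbT.
- by rewrite (IHA env env') ?(IHB env env') // => y yA; apply: h; rewrite mem_cat yA ?orbT.
- have hA v : sat (upd env x v) A <-> sat (upd env' x v) A.
    apply: IH => y yA; rewrite !updE; case: eqP => // /eqP yx.
    by apply: h; rewrite mem_filter /= yx.
  by split=> -[v /hA]; exists v.
- have hA v : sat (upd env x v) A <-> sat (upd env' x v) A.
    apply: IH => y yA; rewrite !updE; case: eqP => // /eqP yx.
    by apply: h; rewrite mem_filter /= yx.
  by split=> hv v; apply/hA.
Qed.

End Syntax.

(** * Form, length and closedness of the machine sentence *)

Section MachineSentence.

Variables (K : nat) (P : seq instr).
Let nreg := K.+1.
Let ncol := nreg + (size P).+1.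

Lemma nnf_exs n B : nnf (exs n B) = nnf B.
Proof. by elim: n. Qed.

Lemma nnf_machine : nnf (Fmachine K P).
Proof.
rewrite /= nnf_exs /= !nnf_bigAnd ?nnf_bigOr //.
- by move=> q; rewrite /= /Finstr; case: onth => // -[].
- move=> i; apply: nnf_bigAnd => j /=.
  by case: eqP => _ /=; case: eqP.
Qed.

Lemma qalt_exs n B : qalt true (exs n B) = qalt true B.
Proof. by elim: n. Qed.

(** Only [Fstep] reaches three: below the existential prefix and its universal quantifier, [Fmove]
    opens existentially and ends universally. The other conjuncts give at most two. *)
Lemma qalt_machine : qalt true (Fmachine K P) <= 3.
Proof.
have nt b x : qalt b (Fnotime K P x) <= 0 by apply: qalt_bigAnd.
rewrite /= qalt_exs /= !geq_max; do !(apply/andP; split=> //).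
- rewrite leq_add2l; apply: (@leq_trans 0) => //; apply: qalt_bigAnd => i.
  by apply: qalt_bigAnd => j /=; case: eqP => _ /=; case: eqP.
- rewrite leq_add2l; apply: (@leq_trans 0) => //; exact: qalt_bigOr.
- rewrite leq_add2l; apply: (@leq_trans 0) => //; exact: qalt_bigAnd.
- by have := nt false 1; have := nt false 2; lia.
- rewrite leq_add2l; apply: (@leq_trans 1) => //; exact: qalt_bigAnd.
- rewrite leq_add2l; apply: qalt_bigAnd => q; rewrite /= /Finstr.
  by case: onth => // -[].
Qed.

Lemma flen_exs n B : flen (exs n B) = n.*2 + flen B.
Proof. by elim: n => //= n ->; lia. Qed.

(** Only the double conjunction in [Fpairs] is quadratic; all other parts are linear in the number
    of colours, and 1000 is a generous constant. *)
Lemma flen_machine : flen (Fmachine K P) <= 1000 * ncol ^ 2.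
Proof.
have pairs : flen (Fpairs K P) <= ncol * (ncol * 49 + 6) + 7.
  have h i j : flen (Fpair K i j) <= 46.
    by rewrite /=; case: eqP => _; case: eqP => _.
  have h' i := @flen_bigAnd ncol (Fpair K i) 46 (h i).
  have := @flen_bigAnd ncol (fun i => bigAnd ncol (Fpair K i)) _ h'.
  by rewrite /Fpairs /= -/ncol; lia.
have col : flen (Fcoloured K P) <= ncol * 12 + 6.
  have := @flen_bigOr ncol (fun i => FOr (FEq 1 (cv i)) (FAdj 1 (cv i))) 9 (fun=> leqnn _).
  by rewrite /Fcoloured /= -/ncol; lia.
have chain : flen (Fchain K) <= nreg * 40 + 11.
  have := @flen_bigAnd nreg (fun j => FOr (NAdj 3 (cv j)) (FOr (NAdj 4 (cv j))
    (FOr (NAdj 3 1) (FOr (FAdj 3 2) (FOr (FAdj 4 1) (NAdj 4 2)))))) 37 (fun=> leqnn _).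
  by rewrite /Fchain /= -/nreg; lia.
have notime x : flen (Fnotime K P x) <= (size P).+1 * 7 + 3.
  exact: (@flen_bigAnd _ (fun q => NAdj x (cv (nreg + q))) 4 (fun=> leqnn _)).
have ext : flen (Fextensional K P) <= 2 * ((size P).+1 * 7 + 3) + 60.
  by have := notime 1; have := notime 2; rewrite /Fextensional /=; lia.
have cov : flen (Fcovered K) <= nreg * 22 + 5.
  have := @flen_bigAnd nreg (fun j =>
    FOr (NAdj 3 (cv j)) (FEx 1 (FAnd (FAdj 1 3) (NEq 1 (cv j))))) 19 (fun=> leqnn _).
  by rewrite /Fcovered /= -/nreg; lia.
have step : flen (Fstep K P) <= size P * 250 + 5.
  have h q : flen (FOr (NAdj 1 (cv (nreg + q))) (Finstr K P q)) <= 247.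
    by rewrite /= /Finstr; case: onth => // -[].
  by have := @flen_bigAnd (size P) _ _ h; rewrite /Fstep /= -/nreg; lia.
(* Here 18 and 21 are the lengths of [Fstart] and [Fhalt]; each 3 is the cost of a conjunction. *)
have -> : flen (Fmachine K P) = 2 + (ncol.*2 + (flen (Fpairs K P) +
    (flen (Fcoloured K P) + (flen (Fchain K) + (flen (Fextensional K P) +
    (flen (Fcovered K) + (18 + (21 + flen (Fstep K P) + 3) + 3) + 3) + 3) + 3) + 3) + 3)).
  by rewrite /Fmachine /= flen_exs.
have nN : nreg <= ncol by rewrite /ncol; lia.
have SN : size P < ncol by rewrite /ncol; lia.
rewrite expnS expn1; nia.
Qed.

Hypothesis wfP : all (wf_instr K (size P)) P.

Lemma sentence_machine : sentence (Fmachine K P).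
Proof.
suff : all pred0 (fv (Fmachine K P)) by rewrite /sentence; case: fv.
rewrite all_fv; pose p y := (10 <= y < ncol.+4.+4.+2) || ((y == 0) || false).
suff h : closed_in p (Fbody K P) by exact: (@closed_exs _ ncol _ h).
have p0 : p 0 by [].
have pc i : i < ncol -> p (cv i) by move=> ic; rewrite /p; lia.
have pr j : j < nreg -> p (cv j) by move=> jn; apply: pc; rewrite /ncol; lia.
have ps q : q <= size P -> p (cv (nreg + q)).
  by move=> qP; apply: pc; rewrite /ncol ltn_add2l.
have pS := ps 0 isT; have pS' := ps _ (leqnn (size P)).
have c0 := pr 0 isT; rewrite /= /Fnotime.
rewrite !closed_bigAnd ?closed_bigOr //= -/nreg ?pS ?pS' ?c0 ?p0 //.
- by move=> i ic; rewrite pc.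
- move=> q qP; rewrite ps ?(ltnW qP) //= /Finstr.
  case onP: onth => [a|] //; have := onth_all wfP onP.
  case: a {onP} => [x q'|x q1 q2] /=; rewrite -/nreg.
    by case/andP=> xK q'P; rewrite !ps ?(ltnW qP) // pr.
  by case/and3P=> xK q1P q2P; rewrite !ps ?(ltnW qP) // pr.
- by move=> j jn; rewrite pr.
- by move=> j jn; rewrite pr.
- move=> i ic; apply: closed_bigAnd => // j jc.
  by rewrite /=; case: eqP => _; case: eqP => _ /=; rewrite ?pc.
Qed.

End MachineSentence.

(** * The sentence defines the graph of the run *)

Section Definability.

Variables (K : nat) (P : seq instr) (T : nat).

Lemma card_rvert : T < #|{: rvert K P T}|.
Proof. by rewrite !card_sum !card_ord; lia. Qed.

Hypothesis wfP : all (wf_instr K (size P)) P.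
Hypothesis haltT : state P T = size P.
Hypothesis runT : forall i, i < T -> state P i < size P.

(** A sentence does not depend on the environment, so the given one is replaced by [env'], which
    already carries the witnesses for the existential prefix. *)
Lemma holds_machine : holds (fin_graph (@radj K P T)) (Fmachine K P).
Proof.
pose env' y : rvert K P T :=
  if y is i.+4.+4.+2 then colour_vertex K P T i else time_vertex K P T 0.
move=> env; apply/(@sat_fv _ env env').
  by have /nilP -> := sentence_machine wfP.
exists (env' 0); rewrite upd_same; apply: exs_sat.
by apply/sat_model; apply: run_model.
Qed.

Lemma def3_machine : def3 (Fmachine K P) (fin_graph (@radj K P T)).
Proof.
split; first exact: nnf_machine.
split; first exact: (leq_trans (alt_qalt (nnf_machine K P)) (qalt_machine K P)).
split; first exact: sentence_machine.
split; first exact: holds_machine.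
case=> V adj [[v] [adj_sym _]] niso hold; apply: niso.
have [env /sat_model M] : exists env, @sat (Graph adj) env (Fbody K P).
  by have [t0 h] := hold (fun _ => v); refine (@sat_exs _ _ (K.+1 + (size P).+1) _ h).
exact: (model_iso wfP haltT runT adj_sym M).
Qed.

End Definability.

(** * Minimal lengths and the contradiction *)

Lemma least_nat (Q : nat -> Prop) : (exists n, Q n) ->
  exists2 m, Q m & forall k, Q k -> m <= k.
Proof.
move=> [n]; elim/ltn_ind: n => n IH Qn.
have [[k kn Qk]|none] := classic (exists2 k, k < n & Q k); first exact: IH kn Qk.
by exists n => // k Qk; rewrite leqNgt; apply/negP => kn; apply: none; exists k.
Qed.

Lemma is_s3_exists (U : finType) (e : rel U) A :
  fin_simple e -> def3 A (fin_graph e) -> exists2 m, is_s3 #|U| m & m <= flen A.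
Proof.
move=> simple_e defA.
have [|m Qm mmin] := @least_nat (fun m => exists (U' : finType) (e' : rel U') (A' : form),
    [/\ #|U'| = #|U|, fin_simple e', def3 A' (fin_graph e') & flen A' = m]).
  by exists (flen A), U, e, A.
exists m; last by apply: mmin; exists U, e, A.
by split=> // U' e' A' cardU' simple_e' defA'; apply: mmin; exists U', e', A'.
Qed.

Lemma pow2_gt_quadratic D : exists N, 1000 * (D * N.+1) ^ 2 < 2 ^ N.
Proof.
(* With [4 n + 1 <= 4 (n + 1)], the factor 16 bounds the left side by [n (n + 1)^2], which is below
   [(n + 1)^4 <= 2^(4 n)]. *)
set n := 16 * 1000 * D ^ 2; exists (4 * n).
have h : n.+1 ^ 4 <= 2 ^ (4 * n).
  by rewrite mulnC expnM leq_exp2r // ltn_expl.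
apply: leq_trans h; rewrite (expnD _ 2 2).
have : 1000 * (D * (4 * n).+1) ^ 2 <= n * n.+1 ^ 2.
  have -> : n * n.+1 ^ 2 = 1000 * (D * (4 * n.+1)) ^ 2.
    rewrite /n !expnMn; move: (D ^ 2) (n.+1 ^ 2) => a b.
    by rewrite (_ : 4 ^ 2 = 16) //; lia.
  by rewrite leq_mul2l leq_exp2r // leq_mul2l; apply/orP; right; lia.
move/leq_ltn_trans; apply; rewrite ltn_pmul2r ?expn_gt0 //.
by rewrite expnS expn1; nia.
Qed.

Theorem theorem4p2 :
  ~ exists f : nat -> nat, general_recursive f /\
      forall n m : nat, 1 <= n -> is_s3 n m -> n <= f m.
Proof.
case=> f [/general_recursive_machine[K [C machines]] bound].
(* The number of colours is at most [K + C + C N + 2], hence at most [(K + C + 2) (N + 1)]. *)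
have [N hN] := pow2_gt_quadratic (K + C + 2).
have [P [T [szP wfP haltT runT large]]] := machines N.
have [m s3m lem] := is_s3_exists (radj_simple K P T) (def3_machine wfP haltT runT).
have cardT := card_rvert K P T.
have mN : m < 2 ^ N.
  apply: leq_ltn_trans (leq_trans lem (flen_machine K P)) (leq_ltn_trans _ hN).
  by rewrite leq_mul2l leq_exp2r //; nia.
have [x fx] := large m mN.
have n1 := leq_ltn_trans (leq0n T) cardT.
(* A register value at time [T] is at most [T], so [f m] is less than the number of vertices. *)
have := leq_trans (leq_trans (bound _ _ n1 s3m) fx) (@value_le P T x.+1).
by rewrite leqNgt cardT.
Qed.
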